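(* Fix an integer $k\ge 2$, let $N=\binom{n}{k-1}$, and write the bias as $b=\frac{\beta N}{\log n}$. Then for every fixed $\varepsilon>0$ and all sufficiently large $n$: Maker wins the Matrix Rank Game on $H_{n,k}$ with bias $b$ if $\beta\le 1-\varepsilon$, and Breaker wins it if $\beta\ge 1+\varepsilon$.
   Context: $H_{n,k}$ is the complete $k$-uniform hypergraph on vertex set $[n]=\{1,\dots,n\}$. In a Maker-Breaker game with bias $b$ (a positive integer) on $H_{n,k}$, two players alternately claim previously unclaimed edges: in each round Maker first claims one edge and then Breaker claims $b$ edges (or all remaining edges, if fewer than $b$ remain). Play continues until all edges are claimed. Maker wins if the set of edges she has claimed has the desired property; otherwise Breaker wins. ''A player wins'' means that this player has a winning strategy. In the Matrix Rank Game, each edge $e=\{i_1,\dots,i_k\}$ corresponds to the column vector $\mathbf{c}_e\in GF_2^n$ over the two-element field $GF_2$ with a $1$ in rows $i_1,\dots,i_k$ and $0$ elsewhere. The desired property is that the matrix over $GF_2$ whose columns are the vectors $\mathbf{c}_e$, for $e$ claimed by Maker, has full rank, meaning rank $n$ if $k$ is odd and rank $n-1$ if $k$ is even. Here $\log$ is the natural logarithm. *)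

(* Defs.v *)
From mathcomp Require Import all_boot all_order all_algebra.
Set Implicit Arguments.
Unset Strict Implicit.
Unset Printing Implicit Defensive.
Import GRing.Theory.
Local Open Scope ring_scope.

Section MakerBreaker.
Variables (E : finType) (b : nat) (goal : pred {set E}).

(** A round [(m, B)] records the element [m] claimed by Maker, then the set [B]
    claimed by Breaker; a history lists the rounds in chronological order. *)
Definition history := seq (E * {set E}).

Definition maker_claims (h : history) : {set E} := [set r.1 | r in h].
Definition breaker_claims (h : history) : {set E} := \bigcup_(r <- h) r.2.
Definition claimed (h : history) : {set E} := maker_claims h :|: breaker_claims h.

Definition maker_legal (h : history) (m : E) : Prop := m \notin claimed h.

(** The minimum covers the last round, where fewer than [b] elements may remain. *)
Definition breaker_legal (h : history) (m : E) (B : {set E}) : Prop :=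
  let free := ~: (m |: claimed h) in
  B \subset free /\ #|B| = minn b #|free|.

Inductive play : history -> Prop :=
| play_nil : play [::]
| play_rcons h m B of play h & maker_legal h m & breaker_legal h m B :
    play (rcons h (m, B)).

Definition complete (h : history) : Prop := claimed h = [set: E].

Definition maker_strategy := history -> E.
Definition breaker_strategy := history -> E -> {set E}.

Definition maker_strategy_legal (s : maker_strategy) : Prop :=
  forall h, play h -> ~ complete h -> maker_legal h (s h).

Definition breaker_strategy_legal (s : breaker_strategy) : Prop :=
  forall h m, play h -> maker_legal h m -> breaker_legal h m (s h m).

Definition maker_follows (s : maker_strategy) (h : history) : Prop :=
  forall h1 m B h2, h = h1 ++ (m, B) :: h2 -> m = s h1.

Definition breaker_follows (s : breaker_strategy) (h : history) : Prop :=
  forall h1 m B h2, h = h1 ++ (m, B) :: h2 -> B = s h1 m.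

Definition maker_wins : Prop :=
  exists2 s : maker_strategy, maker_strategy_legal s &
    forall h, play h -> complete h -> maker_follows s h -> goal (maker_claims h).

Definition breaker_wins : Prop :=
  exists2 s : breaker_strategy, breaker_strategy_legal s &
    forall h, play h -> complete h -> breaker_follows s h ->
      ~~ goal (maker_claims h).

End MakerBreaker.

Notation hedge n k := {e : {set 'I_n} | #|e| == k}.

(** The columns are the incidence vectors of the edges in [M], in the order
    given by [enum_val]. *)
Definition incidence_mx (n k : nat) (M : {set hedge n k}) : 'M['F_2]_(n, #|M|) :=
  \matrix_(i < n, j < #|M|) (i \in val (enum_val j : hedge n k))%:R.

(** For [k] even every column has coordinate sum 0 in ['F_2], so the rank is at
    most [n.-1]. *)
Definition has_full_rank (n k : nat) (M : {set hedge n k}) : bool :=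
  \rank (incidence_mx M) == if odd k then n else n.-1.

Definition rank_game_maker_wins (n k b : nat) : Prop :=
  maker_wins b (@has_full_rank n k).

Definition rank_game_breaker_wins (n k b : nat) : Prop :=
  breaker_wins b (@has_full_rank n k).

(* Main.v *)
(** A row dependency of Maker's matrix is a vertex set [S] that every Maker edge
    meets in an even number of vertices, so full rank means that every relevant
    [S] is hit by a Maker edge [e] with [#|e :&: S|] odd.

    Maker first serves every vertex twice. She always serves the vertex [v] with
    the largest sum of its Breaker degree and [b] times its outstanding services;
    counting each Breaker edge touching a vertex set [J] only once, the average
    of this quantity over [J] grows harmonically as [J] shrinks, which leaves a
    constant fraction of the edges at [v] outside Breaker's reach.  Among those
    edges she takes one that does not increase the expected number of small [S]
    that random choices would leave unhit (method of conditional expectations);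
    two services per vertex make the initial expectation less than 1.  Breaker
    has then spent only [2nb] edges, too few to threaten the linear sized [S],
    which Maker hits by an Erdos-Selfridge potential.

    Breaker fixes about [n / ln n] vertices and first takes all edges containing
    two of them, while Maker touches at most half of them.  The edges at the
    surviving vertices then form disjoint boxes of at most [N] elements, and by
    playing evenly Breaker puts about [b ln n] elements into the last box. *)
Require Import Defs.
From mathcomp Require Import all_boot all_order all_algebra.
From mathcomp Require Import boolp reals sequences exp.
From mathcomp Require Import zify ring lra.
Set Implicit Arguments.
Unset Strict Implicit.
Unset Printing Implicit Defensive.
Import Order.TTheory GRing.Theory Num.Theory.

(** * Positional invariants and winning strategies *)

Lemma subset_between (T : finType) (A F : {set T}) (c : nat) :
  A \subset F -> (#|A| <= c <= #|F|)%N ->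
  exists D : {set T}, [/\ A \subset D, D \subset F & #|D| = c].
Proof.
move=> sAF /andP[cA cF].
elim: c cA cF => [|c IHc] cA cF; first by exists A; split => //; apply/eqP; rewrite -leqn0.
move: cA; rewrite leq_eqVlt => /orP[/eqP cA|cA]; first by exists A.
have [D [sAD sDF cD]] := IHc cA (ltnW cF).
have : (0 < #|F :\: D|)%N by rewrite cardsD (setIidPr sDF) cD subn_gt0.
case/card_gt0P=> x; rewrite inE => /andP[xD xF].
exists (x |: D); split; first by rewrite subsetU // sAD orbT.
  by rewrite subUset sub1set xF.
by rewrite cardsU1 xD cD.
Qed.

Section GameInvariants.
Variables (E : finType) (b : nat) (goal : pred {set E}).
Implicit Types (h : history E) (M B D : {set E}) (m : E).

Lemma maker_claims_nil : maker_claims [::] = set0 :> {set E}.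
Proof. by apply/setP=> x; rewrite inE; apply/imsetP; case. Qed.

Lemma maker_claims_rcons h r : maker_claims (rcons h r) = r.1 |: maker_claims h.
Proof.
apply/setP=> x; rewrite !inE; apply/imsetP/idP.
  case=> r'; rewrite mem_rcons inE => /orP[/eqP-> ->|r'h ->]; first by rewrite eqxx.
  by apply/orP; right; apply/imsetP; exists r'.
case/orP=> [/eqP->|/imsetP[r' r'h ->]].
  by exists r; rewrite // mem_rcons mem_head.
by exists r'; rewrite // mem_rcons inE r'h orbT.
Qed.

Lemma breaker_claims_rcons h r :
  breaker_claims (rcons h r) = breaker_claims h :|: r.2.
Proof. by rewrite /breaker_claims -cats1 big_cat big_seq1. Qed.

(** The strategy picks, by a classical choice, a move that keeps [Inv]. Breaker's reply ranges over
    all sets of at most [b] elements, free or not, so the short last round needs no separate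
    case. *)
Lemma maker_wins_by_invariant (e0 : E) (Inv : {set E} -> {set E} -> Prop) :
  Inv set0 set0 ->
  (forall M B, Inv M B -> M :|: B <> setT ->
     exists2 m, m \notin M :|: B &
       forall D, #|D| <= b -> Inv (m |: M) (B :|: D)) ->
  (forall M B, Inv M B -> M :|: B = setT -> goal M) ->
  maker_wins b goal.
Proof.
move=> Inv0 InvS Inv_goal.
pose good h m := (m \notin claimed h) &&
  `[< forall D, #|D| <= b ->
        Inv (m |: maker_claims h) (breaker_claims h :|: D) >].
(* Legality is demanded on every play, also where [Inv] fails, hence the fallback to any free
   element; [e0] is reached only on a full board. *)
pose s h := if [pick m | good h m] is Some m then m else
            odflt e0 [pick m | m \notin claimed h].
have s_good h : Inv (maker_claims h) (breaker_claims h) -> ~ complete h ->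
    good h (s h).
  move=> Ih nc; rewrite /s; case: pickP => // no_good.
  have [m mN /asboolP mD] := InvS _ _ Ih nc.
  by have := no_good m; rewrite /good mN mD.
exists s.
  move=> h _ nc; rewrite /s; case: pickP => [m /andP[] //|_].
  case: pickP => // none; case: nc; apply/setP=> x.
  by rewrite [RHS]in_setT; apply: negbFE (none x).
move=> h ph; suff inv : maker_follows s h -> Inv (maker_claims h) (breaker_claims h).
  by move=> ch /inv Ih; apply: Inv_goal Ih ch.
elim: ph => [|{}h m B hp IH m_legal [_ cB]] follows.
  by rewrite maker_claims_nil /breaker_claims big_nil.
have follows_h : maker_follows s h.
  move=> h1 m' B' h2 eh; apply: (follows h1 m' B' (rcons h2 (m, B))).
  by rewrite eh rcons_cat rcons_cons.
have em : m = s h by apply: (follows h m B [::]); rewrite cats1.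
have nc : ~ complete h.
  by rewrite /complete => ch; move: m_legal; rewrite /maker_legal ch inE.
have /andP[_ /asboolP] := s_good _ (IH follows_h) nc.
rewrite maker_claims_rcons breaker_claims_rcons /= em; apply.
by rewrite cB geq_minl.
Qed.

(** A legal reply has a forced size, while the invariant only exhibits a useful [D] of at most [b]
    elements. As [Inv] survives every superset of [D], [D] can be padded to that size. *)
Lemma breaker_wins_by_invariant (Inv : {set E} -> {set E} -> Prop) :
  Inv set0 set0 ->
  (forall M B m, Inv M B -> m \notin M :|: B ->
     exists D, [/\ D \subset ~: (m |: (M :|: B)), #|D| <= b &
       forall D', D \subset D' -> Inv (m |: M) (B :|: D')]) ->
  (forall M B, Inv M B -> M :|: B = setT -> ~~ goal M) ->
  breaker_wins b goal.
Proof.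
move=> Inv0 InvS Inv_goal.
pose legal h m B := (B \subset ~: (m |: claimed h)) &&
                    (#|B| == minn b #|~: (m |: claimed h)|).
have legalP h m B : reflect (breaker_legal b h m B) (legal h m B).
  by apply: (iffP andP) => -[? /eqP].
pose good h m B := legal h m B &&
  `[< Inv (m |: maker_claims h) (breaker_claims h :|: B) >].
pose s h m := if [pick B | good h m B] is Some B then B else
              odflt set0 [pick B | legal h m B].
exists s.
  move=> h m _ _; rewrite /s; case: pickP => [B /andP[/legalP] //|_].
  case: pickP => [B /legalP //|none].
  have [||D [_ sD cD]] := @subset_between _ set0 (~: (m |: claimed h))
     (minn b #|~: (m |: claimed h)|); first exact: sub0set.
    by rewrite cards0 geq_minr.
  by have := none D; rewrite /legal sD cD eqxx.
move=> h ph; suff inv : breaker_follows s h -> Inv (maker_claims h) (breaker_claims h).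
  by move=> ch /inv Ih; apply: Inv_goal Ih ch.
elim: ph => [|{}h m B hp IH m_legal _] follows.
  by rewrite maker_claims_nil /breaker_claims big_nil.
have follows_h : breaker_follows s h.
  move=> h1 m' B' h2 eh; apply: (follows h1 m' B' (rcons h2 (m, B))).
  by rewrite eh rcons_cat rcons_cons.
have -> : B = s h m by apply: (follows h m B [::]); rewrite cats1.
rewrite maker_claims_rcons breaker_claims_rcons /= /s.
case: pickP => [D /andP[_ /asboolP] //|none].
have [D [sD cD InvD]] := InvS _ _ _ (IH follows_h) m_legal.
have [|D' [sDD' sD' cD']] := @subset_between _ D (~: (m |: claimed h))
     (minn b #|~: (m |: claimed h)|) sD.
  by rewrite leq_min cD subset_leq_card //= geq_minr.
by have := none D'; rewrite /good /legal sD' cD' eqxx /= => /asboolP []; apply: InvD.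
Qed.

End GameInvariants.

(** * Full rank and edges meeting a set in an odd number of vertices *)

Section Rank.
Local Open Scope ring_scope.

Lemma natr_F2 (m : nat) : (m%:R : 'F_2) = (odd m)%:R.
Proof.
by rewrite -[in LHS](odd_double_half m) natrD -mul2n natrM (_ : 2%:R = 0 :> 'F_2)
   ?mul0r ?addr0 //; apply: val_inj.
Qed.

Variables (n k : nat) (M : {set hedge n k}).

Definition odd_meet (S : {set 'I_n}) : {set hedge n k} :=
  [set e | odd #|val e :&: S|].

Definition char_row (S : {set 'I_n}) : 'rV['F_2]_n := \row_i (i \in S)%:R.

Lemma char_rowP (u : 'rV['F_2]_n) : u = char_row [set i | u 0 i != 0].
Proof.
apply/rowP=> i; rewrite !mxE inE.
by case: (u 0 i) => -[|[|//]] lt; apply: val_inj.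
Qed.

(** Entry [e] of the product is the parity of the number of vertices of [e] in [S]. *)
Lemma char_row_kernel (S : {set 'I_n}) :
  (char_row S *m incidence_mx M == 0) = [disjoint M & odd_meet S].
Proof.
have entry j : (char_row S *m incidence_mx M) 0 j =
    (odd #|val (enum_val j : hedge n k) :&: S|)%:R.
  rewrite mxE -natr_F2 -(sum1_card (mem (_ :&: S))) natr_sum [RHS]big_mkcond /=.
  by apply: eq_bigr => i _; rewrite !mxE -natrM mulnb inE andbC; case: (_ && _).
apply/eqP/idP => [u0|/pred0P dis].
  apply/pred0P=> e /=; apply/negP=> /andP[eM]; rewrite inE => eS.
  by have /rowP/(_ (enum_rank_in eM e)) := u0; rewrite entry enum_rankK_in // eS mxE.
apply/rowP=> j; rewrite entry mxE.
by have := dis (enum_val j); rewrite /= enum_valP inE /= => ->.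
Qed.

(** Every row over ['F_2] is a characteristic row, so the left kernel is zero or, for even [k], the
    line spanned by the all-ones row; [0 < n] makes that row nonzero. *)
Lemma has_full_rank_of_hits :
  (forall S : {set 'I_n}, S != set0 -> (~~ odd k -> S != setT) ->
     ~~ [disjoint M & odd_meet S]) ->
  (~~ odd k -> 0 < n)%N -> has_full_rank M.
Proof.
move=> hits n_gt0; rewrite /has_full_rank.
have hit_row (u : 'rV_n) : u *m incidence_mx M = 0 -> u = 0 \/ (~~ odd k /\ u = char_row setT).
  move=> u0; rewrite (char_rowP u) in u0 *; set S := finset _ in u0 *.
  have [-> |Sn0] := eqVneq S set0; first by left; apply/rowP=> i; rewrite !mxE inE.
  have [ok|ek] := boolP (odd k).
    have /negP[] : ~~ [disjoint M & odd_meet S] by apply: hits; rewrite ?ok.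
    by rewrite -char_row_kernel u0.
  have [-> |SnT] := eqVneq S setT; first by right.
  have /negP[] := hits S Sn0 (fun=> SnT).
  by rewrite -char_row_kernel u0.
have [ok|ek] := boolP (odd k).
  rewrite -/(row_free _) -kermx_eq0; apply/rowV0P=> u /sub_kermxP/hit_row[//|[]].
  by rewrite ok.
have one0 : char_row setT *m incidence_mx M = 0.
  apply/eqP; rewrite char_row_kernel; apply/pred0P=> e /=.
  by rewrite inE setIT (eqP (valP e)) (negPf ek) andbF.
have one_n0 : char_row setT != 0 :> 'rV['F_2]_n.
  have := n_gt0 ek => n0; apply/eqP=> /rowP/(_ (Ordinal n0)).
  by rewrite !mxE inE.
have : \rank (kermx (incidence_mx M)) = 1%N.
  apply/eqP; rewrite eqn_leq; apply/andP; split.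
    apply: leq_trans (rank_leq_row (char_row setT)); apply: mxrankS.
    apply/rV_subP=> u /sub_kermxP/hit_row[-> |[_ ->]] //; exact: sub0mx.
  rewrite lt0n mxrank_eq0; apply/eqP=> k0.
  have /sub_kermxP := one0; rewrite k0 submx0 => /eqP e0.
  by move: one_n0; rewrite e0 eqxx.
rewrite mxrank_ker => /eqP; have := rank_leq_row (incidence_mx M); move: (\rank _) => r.
by rewrite leq_eqVlt => /orP[/eqP->|]; rewrite ?subnn //; case: (n) => // n' rn /eqP; rewrite subSn // => -[] /eqP; rewrite subn_eq0 => nr; rewrite eqn_leq -ltnS rn.
Qed.

(** The characteristic row of [v] lies in the left kernel. For even [k] the all-ones row lies there
    too, and [1 < n] makes the two independent. *)
Lemma untouched_not_full_rank (v : 'I_n) : (1 < n)%N ->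
  (forall e, e \in M -> v \notin val e) -> ~~ has_full_rank M.
Proof.
move=> n_gt1 untouched; rewrite /has_full_rank.
have v0 : (char_row [set v] <= kermx (incidence_mx M))%MS.
  apply/sub_kermxP/eqP; rewrite char_row_kernel; apply/pred0P=> e /=.
  apply/negP=> /andP[/untouched ve]; rewrite inE.
  rewrite (_ : _ :&: _ = set0) ?cards0 //; apply/setP=> x; rewrite !inE.
  by apply/negP=> /andP[xe /eqP xv]; move: ve; rewrite -xv xe.
have v_n0 : char_row [set v] != 0.
  by apply/eqP=> /rowP/(_ v); rewrite !mxE inE eqxx.
have [ok|ek] := boolP (odd k).
  by rewrite -/(row_free _) -kermx_eq0; apply/eqP=> k0; move: v0; rewrite k0 submx0 (negPf v_n0).
have one0 : (char_row setT <= kermx (incidence_mx M))%MS.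
  apply/sub_kermxP/eqP; rewrite char_row_kernel; apply/pred0P=> e /=.
  by rewrite inE setIT (eqP (valP e)) (negPf ek) andbF.
have : (2 <= \rank (kermx (incidence_mx M)))%N.
  have rk2 : \rank (col_mx (char_row [set v]) (char_row setT)) = 2%N.
    apply/eqP; rewrite -/(row_free _) -kermx_eq0; apply/rowV0P=> u /sub_kermxP.
    rewrite -[u]hsubmxK mul_row_col => eu.
    (* Coordinate [w] kills the coefficient of the all-ones row, then coordinate [v] kills the other
       one. *)
    have [w wv] : exists w : 'I_n, w != v.
      have : (0 < #|[set~ v]|)%N by rewrite cardsC1 card_ord; case: (n) n_gt1 => [|[]].
      by case/card_gt0P=> w; rewrite inE; exists w; rewrite -in_set1.
    have r0 : rsubmx u = 0.
      apply/rowP=> i; rewrite (ord1 i) [RHS]mxE; move/rowP/(_ w): eu; rewrite !mxE !big_ord_recl !big_ord0.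
      by rewrite !mxE !inE (negPf wv) mulr0 !addr0 add0r mulr1.
    have l0 : lsubmx u = 0.
      apply/rowP=> i; rewrite (ord1 i) [RHS]mxE; move: eu; rewrite r0 mul0mx addr0 => /rowP/(_ v).
      by rewrite !mxE !big_ord_recl !big_ord0 !mxE !inE eqxx mulr1 addr0.
    by rewrite r0 l0 row_mx0.
  have := mxrankS (_ : (col_mx (char_row [set v]) (char_row setT) <= kermx (incidence_mx M))%MS).
  by rewrite rk2 col_mx_sub v0 one0 => ->.
rewrite mxrank_ker; move: (\rank _) => r; case: (n) n_gt1 => // n' _ /=.
by apply: contraTneq => ->; rewrite subSnn.
Qed.

End Rank.

(** * Counting edges *)

Lemma card_bigcup_le (I T : finType) (P : pred I) (F : I -> {set T}) :
  #|\bigcup_(i | P i) F i| <= \sum_(i | P i) #|F i|.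
Proof.
elim/big_rec2: _ => [|i m U _ le_m]; first by rewrite cards0.
by apply: leq_trans (leq_card_setU _ _).1 _; rewrite leq_add2l.
Qed.

Section EdgeCounts.
Variables (n k : nat).
Implicit Types (e : hedge n k) (S T X J : {set 'I_n}).

Lemma card_hedges (P : pred {set 'I_n}) :
  #|[set e : hedge n k | P (val e)]| = #|[set A : {set 'I_n} | (#|A| == k) && P A]|.
Proof.
rewrite -(card_imset [set e : hedge n k | P (val e)] val_inj).
congr #|pred_of_set _|; apply/setP=> A; rewrite inE; apply/imsetP/andP=> [[e] | [cA PA]].
  by rewrite inE => Pe ->; split=> //; exact: (valP e).
by exists (exist (fun A : {set 'I_n} => #|A| == k) A cA) => //; rewrite inE.
Qed.

Lemma card_hedges_above X : #|X| <= k ->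
  #|[set e : hedge n k | X \subset val e]| = 'C(n - #|X|, k - #|X|).
Proof.
move=> Xk; rewrite (card_hedges (fun A => X \subset A)).
have -> : n - #|X| = #|~: X| by rewrite (cardsCs (~: _)) setCK card_ord.
rewrite -cards_draws.
have inj : {in [set A : {set 'I_n} | A \subset ~: X & #|A| == k - #|X|] &,
            injective (setU X)}.
  move=> A A'; rewrite !inE => /andP[sA _] /andP[sA' _] eAA'.
  have cut (D : {set 'I_n}) : D \subset ~: X -> (X :|: D) :\: X = D.
    by move=> sD; rewrite setDUl setDv set0U; apply/setDidPl; rewrite disjoints_subset.
  by rewrite -(cut A sA) -(cut A' sA') eAA'.
rewrite -(card_in_imset inj); apply: eq_card => A; rewrite !inE.
apply/andP/imsetP=> [[/eqP cA sXA]|[D]].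
  exists (A :\: X); last by rewrite setUC setDE setUIl (setUC (~: X)) setUCr setIT; apply/esym/setUidPl.
  by rewrite inE setDE subsetIr -setDE cardsD (setIidPr sXA) cA eqxx.
rewrite inE => /andP[sD /eqP cD] ->; split; last exact: subsetUl.
by rewrite cardsU cD (_ : X :&: D = set0) ?cards0 ?subn0 ?subnKC //;
   apply/eqP; rewrite setI_eq0 disjoint_sym disjoints_subset.
Qed.

Definition star (v : 'I_n) : {set hedge n k} := [set e : hedge n k | v \in val e].
Definition touching S : {set hedge n k}   := [set e : hedge n k | val e :&: S != set0].
Definition multi S : {set hedge n k}   := [set e : hedge n k | 1 < #|val e :&: S|].

Lemma card_star v : 0 < k -> #|star v| = 'C(n.-1, k.-1).
Proof.
move=> k0; have := @card_hedges_above [set v]; rewrite cards1 !subn1 => <- //.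
by apply: eq_card => e; rewrite !inE sub1set.
Qed.

Lemma card_star2_le u v : 1 < k -> u != v -> #|star u :&: star v| <= 'C(n, k.-2).
Proof.
move=> k1 uv; have := @card_hedges_above [set u; v]; rewrite cards2 uv !subn2 => /(_ k1) eC.
apply: leq_trans (_ : 'C(n.-2, k.-2) <= _); last by apply: leq_bin2l; lia.
rewrite -eC; apply: subset_leq_card; apply/subsetP=> e; rewrite !inE => /andP[ue ve].
by rewrite subUset !sub1set ue.
Qed.

Lemma card_star_touching_le v S : 1 < k -> v \notin S ->
  #|star v :&: touching S| <= #|S| * 'C(n, k.-2).
Proof.
move=> k1 vS.
apply: (@leq_trans #|\bigcup_(u in S) (star v :&: star u)|).
  apply: subset_leq_card; apply/subsetP=> e; rewrite !inE => /andP[ve /set0Pn[u]].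
  by rewrite inE => /andP[ue uS]; apply/bigcupP; exists u => //; rewrite !inE ve.
apply: leq_trans (card_bigcup_le _ _) _; rewrite -sum_nat_const.
apply: leq_sum => u uS; apply: card_star2_le => //.
by apply: contraNneq vS => ->.
Qed.

Lemma card_multi_le S : 1 < k -> #|multi S| <= #|S| ^ 2 * 'C(n, k.-2).
Proof.
move=> k1.
apply: (@leq_trans #|\bigcup_(u in S) (star u :&: touching (S :\ u))|).
  apply: subset_leq_card; apply/subsetP=> e; rewrite inE => /card_gt1P[u [v [ue ve uv]]].
  move: ue ve; rewrite !inE => /andP[ue uS] /andP[ve vS].
  apply/bigcupP; exists u => //; rewrite !inE ue /=; apply/set0Pn; exists v.
  by rewrite !inE ve vS eq_sym uv.
apply: leq_trans (card_bigcup_le _ _) _.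
rewrite expnS expn1 -mulnA -sum_nat_const; apply: leq_sum => u uS.
apply: leq_trans (card_star_touching_le k1 _) _; first by rewrite !inE eqxx.
by rewrite leq_mul2r; apply/orP; right; apply/subset_leq_card/subD1set.
Qed.

Lemma card_odd_meet_odd S : odd k -> 'C(#|S|, k) <= #|odd_meet k S|.
Proof.
move=> ok; rewrite -cards_draws (card_hedges (fun A => odd #|A :&: S|)).
apply: subset_leq_card; apply/subsetP=> A; rewrite !inE => /andP[sA /eqP cA].
by rewrite (setIidPl sA) cA eqxx ok.
Qed.

(** Joining a vertex of [S] to [k - 1] vertices outside [S] gives an edge that meets [S] exactly
    once, and both pieces can be recovered from that edge. *)
Lemma card_odd_meet_proper S : 0 < k ->
  #|S| * 'C(n - #|S|, k.-1) <= #|odd_meet k S|.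
Proof.
move=> k0; have -> : n - #|S| = #|~: S| by rewrite (cardsCs (~: _)) setCK card_ord.
rewrite -cards_draws -cardsX (card_hedges (fun A => odd #|A :&: S|)).
set P := setX _ _; pose f (p : 'I_n * {set 'I_n}) := p.1 |: p.2.
have cutI p : p \in P -> f p :&: S = [set p.1].
  case: p => u A; rewrite !inE /f /= => /and3P[uS sA _].
  rewrite setIUl (_ : A :&: S = set0) ?setU0; last first.
    by apply/eqP; rewrite setI_eq0 disjoints_subset.
  by apply/setIidPl; rewrite sub1set.
have cutD p : p \in P -> f p :\: S = p.2.
  case: p => u A; rewrite !inE /f /= => /and3P[uS sA _].
  rewrite setDUl (_ : [set u] :\: S = set0) ?set0U; last first.
    by apply/eqP; rewrite setD_eq0 sub1set.
  by apply/setDidPl; rewrite disjoints_subset.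
have inj : {in P &, injective f}.
  move=> p q pP qP epq; have /set1_inj e1 : [set p.1] = [set q.1] by rewrite -!cutI // epq.
  by have := cutD p pP; rewrite epq cutD // => e2; case: p q e1 e2 {pP qP epq} => ? ? [? ?] /= -> ->.
rewrite -(card_in_imset inj); apply: subset_leq_card; apply/subsetP=> _ /imsetP[p pP ->].
rewrite inE cutI // cards1 andbT -(cardsID S) cutI // cutD // cards1.
by move: pP; rewrite !inE => /and3P[_ _ /eqP->]; rewrite add1n prednK.
Qed.

(** One bound for both parities: edges inside [S] when [k] is odd, edges with exactly one vertex in
    [S] when [k] is even. *)
Lemma card_odd_meet_ge (m : nat) S : 0 < k -> m <= #|S| ->
  (~~ odd k -> m <= n - #|S|) -> 'C(m, k) <= #|odd_meet k S|.
Proof.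
move=> k0 mS mC; have [ok|ek] := boolP (odd k).
  exact: leq_trans (leq_bin2l _ mS) (card_odd_meet_odd S ok).
apply: leq_trans (card_odd_meet_proper S k0).
apply: (@leq_trans (m * 'C(m, k.-1))); last first.
  by apply: leq_mul => //; apply: leq_bin2l; apply: mC.
have [->|m0] := posnP m; first by rewrite bin0n; case: (k) k0.
(* By absorption, [k * 'C(m, k) = m * 'C(m - 1, k - 1)]. *)
apply: (@leq_trans (k * 'C(m, k))); first by rewrite leq_pmull.
by rewrite -{1 2}(prednK k0) -mul_bin_diag leq_mul2l leq_bin2l ?orbT // leq_pred.
Qed.

(** An edge of even size splits into two parts of equal parity. *)
Lemma odd_meetC S : ~~ odd k -> odd_meet k (~: S) = odd_meet k S.
Proof.
move=> ek; apply/setP=> e; rewrite !inE.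
have := cardsID S (val e); rewrite (eqP (valP e)) setDE => /(congr1 odd).
by rewrite oddD (negPf ek); case: (odd _); case: (odd _).
Qed.

End EdgeCounts.

(** * Breaker's strategy *)

Lemma subset_of_card_min (T : finType) (A : {set T}) (q : nat) :
  exists D : {set T}, [/\ D \subset A, #|D| <= q & #|A :\: D| <= #|A| - q].
Proof.
have [|D [_ sD cD]] := @subset_between _ set0 A (minn q #|A|) (sub0set _).
  by rewrite cards0 geq_minr.
exists D; split=> //; first by rewrite cD geq_minl.
by rewrite cardsD (setIidPr sD) cD; lia.
Qed.

Section BreakerCriterion.
Variables (n k b m : nat).
Hypotheses (k_gt1 : 1 < k) (m_gt0 : 0 < m) (n_large : 2 * m <= n) (n_gt1 : 1 < n).
(** The left side of the implication holds as long as [t] clearing rounds fit into the bound for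
    [multi] on [2 * m] vertices. Maker touches at most [k] vertices per move, so even after one more
    move at least [m] of them are untouched. *)
Hypothesis clearing_time : forall t, b * t <= (2 * m) ^ 2 * 'C(n, k.-2) -> k * t.+1 <= m.
(** With [i] boxes left after Maker's move, Breaker adds [b %/ i] edges to each; over all rounds
    this exhausts any box. *)
Hypothesis boxes_filled : 'C(n, k.-1) <= \sum_(1 <= i < m) b %/ i.

Implicit Types (M B D : {set hedge n k}) (U T : {set 'I_n}).

Definition untouched M T : {set 'I_n} := [set v in T | [disjoint M & star k v]].

(** Here [t] counts the clearing rounds played: each consumed [b] edges of [multi k T] and cost at
    most [k] untouched vertices. *)
Definition clearing T M B : Prop :=
  exists t, #|multi k T :\: (M :|: B)| + b * t <= (2 * m) ^ 2 * 'C(n, k.-2) /\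
            2 * m <= #|untouched M T| + k * t.

(** The boxes are the stars of the vertices in [U]. Edges in two of them already belong to Breaker,
    so the free parts of the boxes are disjoint. *)
Definition filling M B : Prop :=
  exists U, [/\ 0 < #|U| <= m, {in U, forall v, [disjoint M & star k v]},
    multi k U \subset B &
    {in U, forall v, #|star k v :\: B| <= 'C(n, k.-1) - \sum_(#|U| <= i < m) b %/ i}].

Lemma untouched_claim M T e : #|untouched M T| <= #|untouched (e |: M) T| + k.
Proof.
have sub : untouched M T \subset untouched (e |: M) T :|: val e.
  apply/subsetP=> v; rewrite !inE => /andP[-> /= dis].
  rewrite -!setI_eq0 setIUl setU_eq0 (setI_eq0 M) dis andbT setI_eq0 disjoints1 inE.
  by case: (v \in val e).
apply: leq_trans (subset_leq_card sub) (leq_trans (leq_card_setU _ _).1 _).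
by rewrite leq_add2l (eqP (valP e)).
Qed.

Lemma multi_subset U T : U \subset T -> multi k U \subset multi k T.
Proof.
move=> UT; apply/subsetP=> e; rewrite !inE => eU; apply: leq_trans eU _.
by apply: subset_leq_card; apply: setIS.
Qed.

(** A Maker edge contains no untouched vertex, so every claimed edge with two vertices in [U] is
    Breaker's. *)
Lemma filling_of_cleared T M B : m <= #|untouched M T| ->
  multi k T \subset M :|: B -> filling M B.
Proof.
move=> mU cleared.
have [|U [_ UU cU]] := @subset_between _ set0 (untouched M T) m (sub0set _).
  by rewrite cards0.
have un : {in U, forall v, [disjoint M & star k v]}.
  by move=> v /(subsetP UU); rewrite inE => /andP[].
exists U; split => //; first by rewrite cU m_gt0 leqnn.
  apply/subsetP=> e eU.
  have UT : U \subset T by apply: subset_trans UU _; apply/subsetP=> v; rewrite inE => /andP[].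
  have := subsetP cleared e (subsetP (multi_subset UT) e eU).
  rewrite inE => /orP[eM|//].
  have : 0 < #|val e :&: U| by move: eU; rewrite inE; apply: ltnW.
  case/card_gt0P=> v; rewrite inE => /andP[ve /un /pred0P/(_ e)] /=.
  by rewrite eM inE ve.
move=> v _; rewrite cU big_geq // subn0; apply: leq_trans (subset_leq_card (subsetDl _ _)) _.
by rewrite card_star ?(ltnW k_gt1) // leq_bin2l // leq_pred.
Qed.

Lemma clearing_step T M B e : clearing T M B -> e \notin M :|: B ->
  exists D, [/\ D \subset ~: (e |: (M :|: B)), #|D| <= b &
    forall D', D \subset D' ->
      clearing T (e |: M) (B :|: D') \/ filling (e |: M) (B :|: D')].
Proof.
case=> t [left_t unt] _.
have [D [sD cD left_D]] := subset_of_card_min (multi k T :\: (e |: M :|: B)) b.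
exists D; split => //; first by apply: subset_trans sD _; rewrite setDE setUA subsetIr.
move=> D' DD'; have unt' := untouched_claim M T e.
have left' : #|multi k T :\: (e |: M :|: (B :|: D'))| <=
             #|multi k T :\: (e |: M :|: B)| - b.
  apply: leq_trans left_D; apply: subset_leq_card.
  by rewrite setDDl setUA setDS // setUS.
have left_e : #|multi k T :\: (e |: M :|: B)| <= #|multi k T :\: (M :|: B)|.
  by apply: subset_leq_card; rewrite setDS // setSU // subsetUr.
(* Either Breaker's [b] edges exhaust what is left and the filling phase starts, or a full clearing
   round is counted. *)
have [small|big] := leqP #|multi k T :\: (e |: M :|: B)| b.
  right; apply: (@filling_of_cleared T).
    have := clearing_time (leq_trans (leq_addl _ _) left_t); nia.
  rewrite -setD_eq0 -cards_eq0 -leqn0; apply: leq_trans left' _.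
  by rewrite leqn0 subn_eq0.
left; exists t.+1; split; last by rewrite mulnS; lia.
by rewrite mulnS; lia.
Qed.

Lemma filling_step M B e : filling M B -> e \notin M :|: B ->
  exists D, [/\ D \subset ~: (e |: (M :|: B)), #|D| <= b &
    forall D', D \subset D' -> filling (e |: M) (B :|: D')].
Proof.
case=> U [/andP[U0 Um] un multiU boxes] eMB.
have eB : e \notin B by apply: contra eMB; rewrite inE orbC => ->.
(* Maker's edge destroys at most one box. *)
have eU1 : #|val e :&: U| <= 1.
  by rewrite leqNgt; apply: contra eB => e2; apply: (subsetP multiU); rewrite inE.
have un_e v : v \in U -> v \notin val e -> [disjoint e |: M & star k v].
  move=> vU ve; rewrite -!setI_eq0 setIUl setU_eq0 (setI_eq0 M) un // andbT.
  by rewrite setI_eq0 disjoints1 inE.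
(* With a single box left, [boxes_filled] says that it is entirely Breaker's; Maker cannot enter it
   and Breaker may play anything. *)
have [cU|] := leqP #|U| 1.
  have cU1 : #|U| = 1 by apply/eqP; rewrite eqn_leq cU U0.
  have full v : v \in U -> star k v \subset B.
    move=> vU; rewrite -setD_eq0 -cards_eq0 -leqn0; apply: leq_trans (boxes v vU) _.
    by rewrite cU1 leqn0 subn_eq0.
  have Ue v : v \in U -> v \notin val e.
    by move=> vU; apply: contra eB => ve; apply: (subsetP (full v vU)); rewrite inE.
  exists set0; rewrite sub0set cards0; split => // D' _.
  exists U; split; first by rewrite U0.
  - by move=> v vU; apply: un_e => //; apply: Ue.
  - exact: subset_trans multiU (subsetUl _ _).
  move=> v vU; rewrite (_ : _ :\: _ = set0) ?cards0 //.
  by apply/eqP; rewrite setD_eq0 (subset_trans (full v vU)) // subsetUl.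
(* The box hit by Maker is given up; if she hit none, an arbitrary one is dropped, so that the
   number of boxes falls by one in every round. *)
move=> cU; have [u uU eUu] : exists2 u, u \in U & val e :&: U \subset [set u].
  have [eU0|[u uP]] := set_0Vmem (val e :&: U).
    by case/card_gt0P: U0 => u uU; exists u; rewrite // eU0 sub0set.
  exists u; first by move: uP; rewrite inE => /andP[].
  apply/subsetP=> x xP; rewrite inE; apply/eqP; apply: (card_le1_eqP eU1) => //.
pose U' := U :\ u; have cU' : #|U| = #|U'|.+1 by rewrite (cardsD1 u) uU.
have U'0 : 0 < #|U'| by move: cU; rewrite cU' ltnS.
have sU' : U' \subset U by apply: subD1set.
have U'e v : v \in U' -> v \notin val e.
  move=> vU'; apply/negP=> ve; have := subsetP eUu v.
  rewrite !inE ve (subsetP sU' _ vU') => /(_ isT); move: vU'; rewrite !inE.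
  by case: (v == u).
pose q := b %/ #|U'|.
have [box boxP] : exists box : 'I_n -> {set hedge n k}, forall v,
    [/\ box v \subset star k v :\: B, #|box v| <= q &
        #|(star k v :\: B) :\: box v| <= #|star k v :\: B| - q].
  apply: (@fin_all_exists _ (fun=> {set hedge n k}) (fun v D => [/\ D \subset star k v :\: B, #|D| <= q &
        #|(star k v :\: B) :\: D| <= #|star k v :\: B| - q])) => v.
  exact: subset_of_card_min.
pose D := \bigcup_(v in U') box v.
exists D; split.
- apply/bigcupsP=> v vU'; have [sb _ _] := boxP v; apply/subsetP=> x /(subsetP sb).
  rewrite !inE => /andP[xB vx]; rewrite !negb_or xB andbT.
  apply/andP; split; first by apply: contraNneq (U'e v vU') => <-.
  apply/negP=> xM; have := un v (subsetP sU' _ vU').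
  by move/pred0P/(_ x); rewrite /= xM inE vx.
- apply: leq_trans (card_bigcup_le _ _) _.
  apply: (@leq_trans (\sum_(v in U') q)); first by apply: leq_sum => v _; case: (boxP v).
  by rewrite sum_nat_const mulnC leq_trunc_div.
move=> D' DD'; exists U'; split.
- by rewrite U'0 (leq_trans _ Um) // subset_leq_card.
- by move=> v vU'; apply: un_e; [apply: (subsetP sU') | apply: U'e].
- apply: subset_trans (multi_subset sU') (subset_trans multiU _); exact: subsetUl.
move=> v vU'; have [_ _ left_v] := boxP v.
have sub : star k v :\: (B :|: D') \subset (star k v :\: B) :\: box v.
  rewrite setDDl setDS // setUS //; apply: subset_trans DD'.
  exact: (bigcup_sup v).
apply: leq_trans (subset_leq_card sub) (leq_trans left_v _).
have := boxes v (subsetP sU' _ vU'); rewrite cU' => box_v.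
rewrite [X in _ <= _ - X]big_ltn; last by rewrite -cU'.
by rewrite -/q addnC subnDA leq_sub2r.
Qed.

(** Both phases leave an untouched vertex, so Breaker wins even if the board fills up during
    clearing. *)
Lemma rank_game_breaker_criterion : rank_game_breaker_wins n k b.
Proof.
have [|T [_ _ cT]] := @subset_between _ set0 [set: 'I_n] (2 * m) (sub0set _).
  by rewrite cards0 cardsT card_ord n_large.
apply: (@breaker_wins_by_invariant _ _ _ (fun M B => clearing T M B \/ filling M B)).
- left; exists 0; rewrite !muln0 !addn0 -cT; split.
    by apply: leq_trans (card_multi_le _ k_gt1); apply: subset_leq_card; apply: subsetDl.
  rewrite subset_leq_card //; apply/subsetP=> v vT; rewrite inE vT.
  by rewrite -setI_eq0 set0I eqxx.
- move=> M B e [Inv|Inv] eMB; first exact: clearing_step Inv eMB.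
  have [D [sD cD fillD]] := filling_step Inv eMB.
  by exists D; split => // D' DD'; right; apply: fillD.
move=> M B Inv _; have [v unv] : exists v, [disjoint M & star k v].
  case: Inv => [[t [left_t unt]]|[U [/andP[U0 _] un _ _]]]; last first.
    by case/card_gt0P: U0 => v /un; exists v.
  have := clearing_time (leq_trans (leq_addl _ _) left_t) => kt.
  have : 0 < #|untouched M T| by nia.
  by case/card_gt0P=> v; rewrite inE => /andP[_]; exists v.
apply: (@untouched_not_full_rank _ _ _ v n_gt1) => e eM.
by apply/negP=> ve; move/pred0P/(_ e): unv; rewrite /= eM inE ve.
Qed.

End BreakerCriterion.

(** * Estimates *)

Lemma bin_le_expn2 n j : 'C(n, j) <= 2 ^ n.
Proof.
elim: n j => [|n IHn] [|j] //; first by rewrite bin0 expn_gt0.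
by rewrite binS expnS mul2n -addnn leq_add.
Qed.

Lemma ffact_le_expn n j : n ^_ j <= n ^ j.
Proof.
elim: j => [//|j IHj]; rewrite ffactnSr expnSr; apply: leq_mul => //.
exact: leq_subr.
Qed.

Lemma expn_le_ffact n j : (n - j) ^ j <= n ^_ j.
Proof.
rewrite ffact_prod -[j in _ ^ j]card_ord -prod_nat_const.
by apply: leq_prod => i _; apply: leq_sub2l; apply: ltnW.
Qed.

Lemma bin_le_expn n j : 'C(n, j) <= n ^ j.
Proof.
apply: leq_trans (ffact_le_expn n j); rewrite -bin_ffact leq_pmulr //.
exact: fact_gt0.
Qed.

Lemma self_expn_le_fact s : s ^ s <= 4 ^ s * s`!.
Proof.
apply: (@leq_trans ((2 * s) ^_ s)).
  by apply: leq_trans (expn_le_ffact _ _); rewrite mul2n -addnn addnK.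
by rewrite -bin_ffact leq_mul2r (_ : 4 ^ s = 2 ^ (2 * s)) ?bin_le_expn2 ?orbT // expnM.
Qed.

(** A division-free form of the bound of ['C(n, s)] by the [s]-th power of [4 n / s]. *)
Lemma bin_self_expn_le n s : 'C(n, s) * s ^ s <= (4 * n) ^ s.
Proof.
apply: leq_trans (_ : 'C(n, s) * (4 ^ s * s`!) <= _).
  by rewrite leq_mul2l self_expn_le_fact orbT.
by rewrite mulnCA bin_ffact expnMn leq_mul2l ffact_le_expn orbT.
Qed.

Lemma leq_n_bin n j : 0 < j < n -> n <= 'C(n, j).
Proof.
elim: n j => [|n IHn] [|[|j]] //; rewrite ltnS => /= jn; rewrite binS.
  by rewrite bin1 bin0 addn1.
by rewrite -add1n leq_add ?bin_gt0 ?IHn.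
Qed.


(** The ratio of consecutive binomials is [(n - k + 2) / (k - 1)], and [n] is at most twice that
    numerator. *)
Lemma pairs_le n k : 2 <= k -> 2 * k <= n -> n * 'C(n, k.-2) <= 2 * k * 'C(n, k.-1).
Proof.
move=> k2 kn; have := mul_bin_left n k.-2; rewrite (_ : k.-2.+1 = k.-1); last by lia.
move: ('C(n, k.-2)) ('C(n, k.-1)) => P N eN.
have : n * P <= 2 * (n - k.-2) * P by rewrite leq_mul2r; apply/orP; right; lia.
rewrite -mulnA -eN mulnA => le; apply: leq_trans le _.
by rewrite leq_mul2r leq_mul2l leq_pred !orbT.
Qed.

Local Open Scope ring_scope.

Section RealEstimates.
Variable R : realType.
Implicit Types (x y c : R).

(** Used with small [c], this is an explicit form of [ln x = o(x)]. *)
Lemma ln_le_linear c x : 0 < c -> 0 < x -> ln x <= c * x - ln c.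
Proof.
move=> c0 x0; rewrite lerBrDr -lnM ?posrE // [x * c]mulrC.
by apply: ltW; apply: ln_sublinear; rewrite mulr_gt0.
Qed.

Lemma harmonic_ge_ln (m : nat) : (0 < m)%N -> ln m%:R <= \sum_(1 <= i < m) i%:R^-1 :> R.
Proof.
elim: m => [//|[|m] IHm] _; first by rewrite ln1 big_geq.
rewrite big_nat_recr //=; set M := m.+1%:R in IHm *.
have M0 : 0 < M :> R by rewrite /M.
have -> : m.+2%:R = M * (1 + M^-1) :> R.
  by rewrite mulrDr mulr1 divff ?gt_eqF // /M -(natr1 m.+1).
rewrite lnM ?posrE ?addr_gt0 ?invr_gt0 // lerD ?IHm // le_ln1Dx //.
by apply: lt_trans (_ : 0 < _); rewrite ?ltrN10 ?invr_gt0.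
Qed.

Lemma harmonic_le_ln (m : nat) : (0 < m)%N -> \sum_(1 <= i < m.+1) i%:R^-1 <= 1 + ln m%:R :> R.
Proof.
elim: m => [//|[|m] IHm] _; first by rewrite ln1 addr0 big_nat1 invr1.
rewrite big_nat_recr //=; set M := m.+2%:R.
have M0 : 0 < M :> R by rewrite /M.
have M1 : 1 < M :> R by rewrite /M ltr1n.
have eM : m.+1%:R = M * (1 - M^-1) :> R.
  by rewrite mulrBr mulr1 divff ?gt_eqF // /M -(natr1 m.+1) addrK.
have Mi : M^-1 < 1 by rewrite invf_lt1.
apply: le_trans (_ : 1 + ln m.+1%:R + M^-1 <= _); first by rewrite lerD2r IHm.
rewrite -addrA lerD2l eM lnM ?posrE ?subr_gt0 // -addrA -lerBrDl subrr.
rewrite -lerBrDr sub0r; apply: le_ln1Dx; by rewrite ltrN2.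
Qed.

Lemma large_nat_ln (X : R) : exists n0 : nat, forall n, (n0 <= n)%N -> X <= n%:R /\ X <= ln n%:R.
Proof.
pose Y := expR (Num.max X 0); exists (Num.truncn Y).+1 => n n0n.
have Yn : Y <= n%:R.
  apply: le_trans (_ : (Num.truncn Y).+1%:R <= _); first exact: ltW (truncnS_gt _).
  by rewrite ler_nat.
have X_le : X <= Num.max X 0 by rewrite le_max lexx.
have n_gt0 : 0 < n%:R :> R by apply: lt_le_trans Yn; apply: expR_gt0.
split; first by apply: le_trans Yn; apply: le_trans (expR_ge1Dx _); apply: le_trans X_le _; rewrite lerDr.
by apply: le_trans X_le _; rewrite -[Num.max X 0]expRK ler_ln ?posrE ?expR_gt0.
Qed.

Lemma truncn_half (y : R) : 2 <= y -> exists m : nat, [/\ (0 < m)%N, m%:R <= y & y <= 2 * m%:R].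
Proof.
move=> y2; have y0 : 0 <= y by apply: le_trans y2.
have /andP[le lt] := truncn_itv y0; exists (Num.truncn y); split=> //.
  by rewrite truncn_gt0; apply: le_trans y2; rewrite ler1n.
move: lt; rewrite -natr1; set t := _%:R in le *; lra.
Qed.

End RealEstimates.

(** * Parameters for Breaker *)

Section Asymptotics.
Variables (R : realType) (k : nat).
Hypothesis k_gt1 : (1 < k)%N.

(** Take [m] between half of [c n / ln n] and all of it. Clearing is then short, and [ln m] is close
    enough to [ln n] for the harmonic sum to exceed the box size. *)
Lemma breaker_parameters (eps : R) : 0 < eps -> exists n0 : nat, forall n, (n0 <= n)%N ->
  forall b : nat, (1 + eps) * 'C(n, k.-1)%:R <= b%:R * ln n%:R ->
  exists m : nat, [/\ (0 < m)%N, (2 * m <= n)%N,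
    (forall t, b * t <= (2 * m) ^ 2 * 'C(n, k.-2) -> k * t.+1 <= m)%N &
    ('C(n, k.-1) <= \sum_(1 <= i < m) b %/ i)%N].
Proof.
move=> eps0; pose K : R := k%:R.
have K2 : 2 <= K by rewrite /K ler_nat.
have K0 : 0 < K by lra.
(* The clearing estimate ends in [2 k t <= 16 k^2 c m], so this [c] gives exactly [m]; [2 k <= m]
   covers the extra round. *)
pose c : R := (16 * K ^+ 2)^-1.
have K2_ge : 4 <= K ^+ 2 by rewrite expr2; nra.
have c0 : 0 < c by rewrite invr_gt0; lra.
have cK : c * (16 * K ^+ 2) = 1 by rewrite mulVf // gt_eqF //; lra.
have c1 : c <= 64^-1 by rewrite lef_pV2 ?posrE; lra.
(* Replacing [ln n] by [(1 - eta) ln n] uses up half of the surplus [eps]. *)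
pose eta := eps / (2 * (1 + eps)).
have eta0 : 0 < eta by rewrite divr_gt0 // mulr_gt0 //; lra.
have eta_eq : eta * (2 * (1 + eps)) = eps by rewrite divfK // gt_eqF //; lra.
(* This yields [ln n <= c n / (4 k)] for large [n], hence [2 k <= m]. *)
pose eta' := c / (8 * K).
have eta'0 : 0 < eta' by rewrite divr_gt0 //; lra.
have eta'_eq : eta' * (8 * K) = c by rewrite divfK // gt_eqF //; lra.
pose L := - ln (c / 2) - ln eta.
pose X : R := Num.max (Num.max (2 * k%:R) (- ln eta' / eta')) (Num.max 1 (((1 + eps) * L + 1) * (2 / eps))).
have [n0 n0P] := large_nat_ln X; exists n0 => n /n0P[Xn Xx] b.
move: Xn Xx; rewrite /X !ge_max => /andP[/andP[n_2k n_eta'] _] /andP[_ /andP[x1 x_large]].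
have n_2kN : (2 * k <= n)%N by rewrite -(ler_nat R) natrM.
have nN : (n <= 'C(n, k.-1))%N by apply: leq_n_bin; move: n_2kN k_gt1; clear; lia.
have pairs := pairs_le k_gt1 n_2kN.
have n0R : 0 < n%:R :> R by rewrite ltr0n; move: n_2kN k_gt1; clear; lia.
set x := ln n%:R in x1 x_large *; have x0 : 0 < x by lra.
have x_le : x * (4 * K) <= c * n%:R.
  have := ln_le_linear eta'0 n0R; rewrite -/x => x_le.
  have : - ln eta' <= n%:R * eta' by rewrite -ler_pdivrMr.
  have : eta' * n%:R * (8 * K) = c * n%:R by rewrite mulrAC eta'_eq.
  by move: (eta' * n%:R) (mulrC n%:R eta') x_le => u -> ? ? ?; nra.
pose N : R := 'C(n, k.-1)%:R.
have N_ge : n%:R <= N by rewrite ler_nat.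
have N0 : 0 < N by lra.
rewrite -/N => b_ge.
pose y := c * n%:R / x.
have yx : y * x = c * n%:R by rewrite divfK // gt_eqF.
have y_ge : 4 * K <= y by rewrite /y ler_pdivlMr // mulrC.
have [|m [m0 m_le m_ge]] := @truncn_half _ y; first by lra.
have m0R : 0 < m%:R :> R by rewrite ltr0n.
have mx : m%:R * x <= c * n%:R by rewrite -yx ler_pM2r.
have m_2k : (2 * k <= m)%N by rewrite -(ler_nat R) natrM -/K; lra.
exists m; split => //.
- rewrite -(ler_nat R) natrM; nra.
- move=> t bt.
  have {}bt : b%:R * t%:R <= 4 * m%:R ^+ 2 * 'C(n, k.-2)%:R :> R.
    by move: bt; rewrite (_ : (2 * m) ^ 2 = 4 * (m * m))%N -?(ler_nat R) ?natrM -?expr2 //; clear; lia.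
  have {}pairs : n%:R * 'C(n, k.-2)%:R <= 2 * K * N.
    by move: pairs; rewrite -(ler_nat R) !natrM.
  suff : 2 * K * t%:R <= m%:R.
    rewrite /K -!natrM ler_nat; move: m_2k; clear; rewrite mulnS; nia.
  move: bt pairs; move: (t%:R) (ler0n R t) ('C(n, k.-2)%:R) (ler0n R 'C(n, k.-2)) => T T0 P P0 bT PN.
  have h1 : N * T <= x * (4 * m%:R ^+ 2 * P).
    apply: le_trans (_ : x * (b%:R * T) <= _); last by rewrite ler_pM2l.
    by rewrite mulrA ler_wpM2r // (le_trans _ (_ : (1 + eps) * N <= _)) // ?[x * _]mulrC //; nra.
  have h2 : n%:R * T * N <= 8 * K * (x * m%:R) * m%:R * N.
    apply: le_trans (_ : n%:R * (x * (4 * m%:R ^+ 2 * P)) <= _).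
      by rewrite -mulrA [T * N]mulrC ler_pM2l.
    have -> : n%:R * (x * (4 * m%:R ^+ 2 * P)) = (4 * x * m%:R ^+ 2) * (n%:R * P) by ring.
    have -> : 8 * K * (x * m%:R) * m%:R * N = (4 * x * m%:R ^+ 2) * (2 * K * N) by ring.
    by rewrite ler_wpM2l // !mulr_ge0 // ?exprn_ge0 // ltW.
  rewrite ler_pM2r // in h2.
  have h3 : n%:R * T <= 8 * K * (c * n%:R) * m%:R.
    apply: le_trans h2 _; rewrite ler_pM2r // ler_pM2l; last by lra.
    by rewrite mulrC.
  have h4 : n%:R * T <= n%:R * (8 * K * c * m%:R) by rewrite (_ : _ * (_ * m%:R) = 8 * K * (c * n%:R) * m%:R) //; ring.
  rewrite ler_pM2l // in h4.
  have h5 : 2 * K * T <= 2 * K * (8 * K * c * m%:R) by rewrite ler_pM2l //; lra.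
  apply: le_trans h5 _.
  have -> : 2 * K * (8 * K * c * m%:R) = c * (16 * K ^+ 2) * m%:R by ring.
  by rewrite cK mul1r.
rewrite -(ler_nat R) natr_sum.
(* Each floor loses at most 1, in total at most [m]. *)
have sum_ge : b%:R * ln m%:R - m%:R <= \sum_(1 <= i < m) (b %/ i)%:R :> R.
  apply: le_trans (_ : \sum_(1 <= i < m) (b%:R * i%:R^-1 - 1) <= _); last first.
    rewrite !big_nat; apply: ler_sum => i /andP[i1 _].
    rewrite lerBlDr natr1 ler_pdivrMr ?ltr0n // -natrM ler_nat.
    by rewrite ltnW // ltn_ceil.
  rewrite big_split /= -mulr_sumr sumrN sumr_const_nat; apply: lerB.
    by rewrite ler_wpM2l // harmonic_ge_ln.
  by rewrite ler_nat leq_subr.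
apply: le_trans sum_ge; rewrite -/N.
have ln_m : (1 - eta) * x - L <= ln m%:R.
  apply: le_trans (_ : ln (c / 2 * n%:R / x) <= _); last first.
    rewrite ler_ln ?posrE //; last by rewrite divr_gt0 // mulr_gt0 // divr_gt0.
    rewrite ler_pdivrMr //; move: m_ge; rewrite -(ler_pM2r x0) yx; lra.
  have c2 : 0 < c / 2 by rewrite divr_gt0.
  have c2n : 0 < c / 2 * n%:R by rewrite mulr_gt0.
  rewrite ln_div ?posrE // lnM ?posrE // -/x.
  have := ln_le_linear eta0 x0; rewrite /L; lra.
have ln_m0 : 0 <= ln m%:R :> R by rewrite ln_ge0 // ler1n.
(* The rounding loss [m] is at most [N / ln n], paid for by the summand 1 in [x + 1] below. *)
have m_N : m%:R * x <= N.
  by apply: le_trans mx _; apply: le_trans N_ge; rewrite ler_piMl //; lra.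
have x_large' : (1 + eps) * L + 1 <= eps / 2 * x.
  by move: x_large; rewrite -ler_pdivlMr ?divr_gt0 // invf_div [x * _]mulrC.
rewrite -(ler_pM2r x0) mulrBl [b%:R * _ * _]mulrAC.
have h1 : (1 + eps) * N * ((1 - eta) * x - L) <= b%:R * x * ln m%:R.
  apply: le_trans (_ : (1 + eps) * N * ln m%:R <= _).
    by rewrite ler_wpM2l // mulr_ge0 // ltW //; lra.
  by rewrite ler_wpM2r.
have h2 : N * (x + 1) <= (1 + eps) * N * ((1 - eta) * x - L).
  rewrite [(1 + eps) * N]mulrC -mulrA ler_pM2l //.
  have -> : (1 + eps) * ((1 - eta) * x - L) = (1 + eps) * x - (eta * (2 * (1 + eps))) / 2 * x - (1 + eps) * L by lra.
  rewrite eta_eq; lra.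
lra.
Qed.

End Asymptotics.

(** * Maker's strategy *)

Section ErdosSelfridge.
Variables (R : realFieldType) (E I : finType) (A : I -> {set E}) (P : pred I).
Variable b : nat.
Hypothesis b_gt0 : (0 < b)%N.
Implicit Types (M B D : {set E}).

(** A rational stand-in for the base [2^(1/b)]: its [b]-th power is at most 2 and its [2 b]-th power
    at least 2. *)
Definition es_base : R := 1 + (2 * b%:R)^-1.

Lemma es_base_ge1 : 1 <= es_base.
Proof. by rewrite lerDl invr_ge0 mulr_ge0. Qed.

(** One more factor adds [(1 + x / b) / (2 b)], which is at most [1 / b] since [x <= b]. *)
Lemma es_base_expr_le (x : nat) : (x <= b)%N -> es_base ^+ x <= 1 + x%:R / b%:R.
Proof.
have b0 : 0 < b%:R :> R by rewrite ltr0n.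
have base_eq : es_base = 1 + 2^-1 * b%:R^-1 by rewrite /es_base invfM.
have i0 : 0 < b%:R^-1 :> R by rewrite invr_gt0.
elim: x => [|x IHx] xb; first by rewrite expr0 mul0r addr0.
have {IHx} IHx := IHx (ltnW xb).
have x_le : x%:R / b%:R <= 1 :> R by rewrite ler_pdivrMr // mul1r ler_nat ltnW.
apply: le_trans (_ : es_base * (1 + x%:R / b%:R) <= _).
  by rewrite exprS ler_wpM2l // (le_trans ler01 es_base_ge1).
rewrite base_eq -(natr1 x) [(_ + 1) / _]mulrDl mul1r.
have : 0 <= b%:R^-1 * (1 - x%:R / b%:R) :> R by rewrite mulr_ge0 ?subr_ge0 // ltW.
by lra.
Qed.

Lemma es_base_expr_ge : 2 <= es_base ^+ (2 * b).
Proof.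
have b0 : 0 < b%:R :> R by rewrite ltr0n.
have bern (a : R) (x : nat) : 0 <= a -> 1 + x%:R * a <= (1 + a) ^+ x.
  move=> a0; elim: x => [|x IHx]; first by rewrite mul0r addr0 expr0.
  rewrite exprS -(natr1 x); have : 0 <= x%:R :> R by []. 
  move: (x%:R : R) ((1 + a) ^+ x) IHx => y z; nra.
apply: le_trans (bern _ _ _); last by rewrite invr_ge0 mulr_ge0.
by rewrite natrM divff // mulf_neq0 // ?pnatr_eq0 // -lt0n.
Qed.

Definition es_potential M B : R :=
  \sum_(i | P i && [disjoint M & A i]) es_base ^+ #|B :&: A i|.

Lemma disjointsU1l (m : E) M (X : {set E}) :
  [disjoint m |: M & X] = (m \notin X) && [disjoint M & X].
Proof. by rewrite -!setI_eq0 setIUl setU_eq0 setI_eq0 disjoints1. Qed.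

(** Maker takes the free element [m] of largest weight [w] and removes [w m] from the potential.
    Each of Breaker's at most [b] elements then adds at most [w m / b]. *)
Lemma es_step M B : M :|: B <> setT ->
  exists2 m, m \notin M :|: B &
    forall D, (#|D| <= b)%N -> es_potential (m |: M) (B :|: D) <= es_potential M B.
Proof.
move=> nc; have b0 : 0 < b%:R :> R by rewrite ltr0n.
have lam0 : 0 < es_base by apply: lt_le_trans es_base_ge1.
pose w e := \sum_(i | (P i && [disjoint M & A i]) && (e \in A i)) es_base ^+ #|B :&: A i|.
have [m0 m0_free] : exists m0, m0 \in ~: (M :|: B).
  by apply/set0Pn; apply: contra_notN nc => /eqP /(congr1 (@setC _)); rewrite setCK setC0.
have [m /= m_free m_max] := @arg_maxP _ _ _ m0 (fun e => e \in ~: (M :|: B)) w m0_free.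
exists m => [|D cD]; first by rewrite inE in m_free.
(* Elements of [D] already in [B] change nothing, and those in [M] lie in no surviving [A i]. *)
pose F := D :&: ~: (M :|: B).
have w_ge0 : 0 <= w m by apply: sumr_ge0 => i _; rewrite exprn_ge0 // ltW.
have split_pot : es_potential M B = w m +
    \sum_(i | P i && [disjoint m |: M & A i]) es_base ^+ #|B :&: A i|.
  rewrite /es_potential (bigID (fun i => m \in A i)) /=; congr (_ + _).
  by apply: eq_bigl => i; rewrite disjointsU1l -andbA; congr (_ && _); rewrite andbC.
have new_le i : P i && [disjoint m |: M & A i] -> es_base ^+ #|(B :|: D) :&: A i| <=
    es_base ^+ #|B :&: A i| + \sum_(e in F | e \in A i) es_base ^+ #|B :&: A i| / b%:R.
  move=> /andP[_]; rewrite disjointsU1l => /andP[_ dis].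
  have le_card : (#|(B :|: D) :&: A i| <= #|B :&: A i| + #|F :&: A i|)%N.
    apply: leq_trans (leq_card_setU _ _).1; apply: subset_leq_card.
    apply/subsetP=> e; rewrite !inE => /andP[eBD eA]; rewrite eA !andbT.
    have -> : e \in M = false by apply/negP=> eM; move/pred0P/(_ e): dis; rewrite /= eM eA.
    by case: (e \in B) eBD => //= ->.
  apply: le_trans (ler_weXn2l es_base_ge1 le_card) _.
  rewrite exprD sumr_const.
  have -> : #|[pred e | (e \in F) && (e \in A i)]| = #|F :&: A i|.
    by apply: eq_card => e; rewrite !inE.
  apply: le_trans (_ : es_base ^+ #|B :&: A i| * (1 + #|F :&: A i|%:R / b%:R) <= _).
    rewrite ler_pM2l ?exprn_gt0 //; apply: es_base_expr_le.
    by apply: leq_trans cD; apply: subset_leq_card; rewrite -setIA subsetIl.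
  by rewrite mulrDr mulr1 lerD2l -[X in _ <= X]mulr_natl mulrCA mulrA.
rewrite split_pot {1}/es_potential; apply: le_trans (ler_sum _ new_le) _.
rewrite big_split /= addrC lerD2r.
rewrite (exchange_big_dep (mem F)) /=; last by move=> i e _ /andP[].
apply: (@le_trans _ _ (\sum_(e in F) w m / b%:R)).
  apply: ler_sum => e eF; apply: (@le_trans _ _ (w e / b%:R)).
    rewrite /w mulr_suml [X in X <= _]big_mkcond [X in _ <= X]big_mkcond /=.
    apply: ler_sum => i _; rewrite disjointsU1l; case: (P i) => //=.
    case: [disjoint M & A i]; rewrite ?andbF //= andbT; case: (e \in A i); rewrite ?andbF //=.
    rewrite eF; case: (m \notin _) => //=; apply: divr_ge0 => //.
    by rewrite exprn_ge0 // ltW.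
  rewrite ler_pM2r ?invr_gt0 //; apply: m_max.
  by move: eF; rewrite inE => /andP[].
rewrite sumr_const -[X in X <= _]mulr_natl mulrCA -[X in _ <= X]mulr1.
rewrite ler_wpM2l // ler_pdivrMr // mul1r ler_nat.
by apply: leq_trans cD; apply: subset_leq_card; apply: subsetIl.
Qed.

End ErdosSelfridge.

(** * Serving every vertex twice *)

Section Services.
Variables (n k b : nat).
Implicit Types (M B D : {set hedge n k}) (S J : {set 'I_n}) (r : 'I_n -> nat) (v : 'I_n).

Definition remaining r S : nat := \sum_(u in S) r u.

Definition serve r v : 'I_n -> nat := fun u => (r u - (u == v))%N.

Definition danger r B J : nat := #|B :&: touching k J| + b * remaining r J.

Lemma remaining_serve r v S : (0 < r v)%N ->
  remaining r S = ((v \in S) + remaining (serve r v) S)%N.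
Proof.
move=> rv; rewrite /remaining /serve; case: (boolP (v \in S)) => vS.
  rewrite !(bigD1 v vS) /= eqxx addnA subnKC //; congr (_ + _)%N.
  by apply: eq_bigr => u /andP[_ /negPf->]; rewrite subn0.
by apply: eq_bigr => u uS; case: eqP uS vS => [-> -> //|_]; rewrite subn0.
Qed.

Lemma touching1 v : touching k [set v] = star k v.
Proof.
apply/setP=> e; rewrite !inE; apply/set0Pn/idP => [[u]|ve].
  by rewrite !inE => /andP[ue /eqP <-].
by exists v; rewrite !inE ve eqxx.
Qed.

Lemma danger_le_sum r B J : (danger r B J <= \sum_(v in J) danger r B [set v])%N.
Proof.
rewrite /danger big_split /= leq_add //; last first.
  by rewrite -big_distrr /= leq_mul2l /remaining leq_sum ?orbT // => v _; rewrite big_set1.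
apply: leq_trans (card_bigcup_le _ _); apply: subset_leq_card; apply/subsetP=> e.
rewrite !inE => /andP[eB /set0Pn[u]]; rewrite inE => /andP[ue uJ].
by apply/bigcupP; exists u; rewrite // touching1 !inE eB.
Qed.

(** A service inside [J] lowers the outstanding term by [b], which pays for Breaker's whole reply,
    because [touching] counts each edge once. *)
Lemma danger_reply r B D J v : (0 < r v)%N -> (#|D| <= b)%N ->
  (danger (serve r v) (B :|: D) J + b * (v \in J) <= danger r B J + b)%N.
Proof.
move=> rv cD; rewrite /danger (remaining_serve J rv) mulnDr; move: (b * (v \in J))%N => x.
suff : (#|(B :|: D) :&: touching k J| <= #|B :&: touching k J| + b)%N by lia.
rewrite setIUl; apply: leq_trans (leq_card_setU _ _).1 _; rewrite leq_add2l.
by apply: leq_trans cD; apply: subset_leq_card; apply: subsetIl.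
Qed.

Definition in_budget r B := (#|B| + b * remaining r setT <= 2 * n * b)%N.

Lemma in_budget_reply r B D v : (0 < r v)%N -> (#|D| <= b)%N ->
  in_budget r B -> in_budget (serve r v) (B :|: D).
Proof.
rewrite /in_budget => rv cD; rewrite (remaining_serve setT rv) inE.
by have := (leq_card_setU B D).1; nia.
Qed.

Lemma danger_le_budget r B J : in_budget r B -> (danger r B J <= 2 * n * b)%N.
Proof.
apply: leq_trans; rewrite /danger leq_add ?subset_leq_card ?subsetIl //.
rewrite leq_mul2l /remaining [X in (_ <= X)%N](big_setID J) /= setTI leq_addr.
by rewrite orbT.
Qed.

Hypothesis k_gt1 : (1 < k)%N.

(** By inclusion-exclusion, only edges through [v] that also meet [J] are counted twice. *)
Lemma danger_setU1 r B J v : v \notin J ->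
  (danger r B J + danger r B [set v] <= danger r B (v |: J) + #|J| * 'C(n, k.-2))%N.
Proof.
move=> vJ; rewrite /danger touching1.
have -> : remaining r (v |: J) = (r v + remaining r J)%N by rewrite /remaining big_setU1.
have -> : remaining r [set v] = r v by rewrite /remaining big_set1.
rewrite mulnDr.
suff : (#|B :&: touching k J| + #|B :&: star k v| <=
        #|B :&: touching k (v |: J)| + #|J| * 'C(n, k.-2))%N by lia.
rewrite -cardsUI leq_add //.
  apply: subset_leq_card; apply/subsetP=> e; rewrite !inE -andb_orr => /andP[-> /=].
  case/orP=> [/set0Pn[u /setIP[ue uJ]]|ve]; apply/set0Pn; last by exists v; rewrite !inE eqxx ve.
  by exists u; rewrite !inE ue uJ orbT.
apply: leq_trans (card_star_touching_le k_gt1 vJ); apply: subset_leq_card.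
by apply/subsetP=> e; rewrite !inE => /andP[/andP[_ ->] /andP[_ ->]].
Qed.

Variable (R : realFieldType).
Variable m : nat.
Hypothesis m_gt0 : (0 < m)%N.

Let pairs : R := 'C(n, k.-2)%:R.

(** [danger_cap j] bounds the average danger of [j] vertices that still await
    service. *)
Definition danger_cap (j : nat) : R :=
  (2 * n * b)%:R / m%:R + \sum_(j <= i < m) (b%:R / i%:R + pairs).

Lemma danger_capS j : (j < m)%N ->
  danger_cap j = b%:R / j%:R + pairs + danger_cap j.+1.
Proof. by move=> jm; rewrite /danger_cap big_ltn // addrCA. Qed.

Definition danger_capped r B :=
  forall J, J != set0 -> (#|J| <= m)%N -> {in J, forall u, (0 < r u)%N} ->
    (danger r B J)%:R <= #|J|%:R * danger_cap #|J|.

(* If [v] is outside [J], compare [J] with [v |: J]: by the choice of [v] its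
   average danger was, up to the double counted edges, at least that of [J]. *)
Lemma danger_capped_reply r B D v : (0 < r v)%N -> (#|D| <= b)%N ->
  (forall u, (0 < r u)%N -> (danger r B [set u] <= danger r B [set v])%N) ->
  in_budget r B -> danger_capped r B -> danger_capped (serve r v) (B :|: D).
Proof.
move=> rv cD v_max budget capped J J0 Jm act.
have cJ0 : (0 < #|J|)%N by rewrite card_gt0.
have cJ0R : 0 < #|J|%:R :> R by rewrite ltr0n.
have actr : {in J, forall u, (0 < r u)%N}.
  by move=> u /act; rewrite /serve; case: (r u).
(* At size [m] the cap is the whole budget, spread over [m] vertices. *)
move: Jm; rewrite leq_eqVlt => /orP[/eqP Jm|Jm].
  rewrite Jm /danger_cap big_geq // addr0 mulrCA divff ?mulr1 ?pnatr_eq0 -?lt0n //.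
  by rewrite ler_nat; apply: danger_le_budget; apply: in_budget_reply.
have reply := danger_reply B J rv cD.
have [vJ|vJ] := boolP (v \in J).
  apply: le_trans (capped J J0 (ltnW Jm) actr); rewrite ler_nat.
  by move: reply; rewrite vJ muln1 leq_add2r.
have cvJ : #|v |: J| = #|J|.+1 by rewrite cardsU1 vJ.
have capU : (danger r B (v |: J))%:R <= #|J|.+1%:R * danger_cap #|J|.+1.
  rewrite -cvJ; apply: capped; rewrite ?cvJ //.
    by apply/set0Pn; exists v; rewrite !inE eqxx.
  by move=> u; rewrite !inE => /orP[/eqP->|/actr].
have supU := danger_setU1 r B vJ.
have avg : (danger r B J <= #|J| * danger r B [set v])%N.
  apply: leq_trans (danger_le_sum r B J) _; rewrite -sum_nat_const.
  by apply: leq_sum => u /actr; apply: v_max.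
rewrite (negPf vJ) muln0 addn0 in reply.
rewrite (danger_capS Jm) mulrDr mulrDr mulrCA divff ?lt0r_neq0 // mulr1.
have pairs0 : 0 <= pairs by rewrite ler0n.
move: capU supU avg reply.
move: (danger r B J) (danger r B (v |: J)) (danger r B [set v])
  (danger (serve r v) _ J) => dJ dU dv d'.
rewrite -!(ler_nat R) !natrD !natrM -(natr1 #|J|) -/pairs.
move: (danger_cap _) (pairs) pairs0 (#|J|%:R) cJ0R (dJ%:R) (dU%:R) (dv%:R) (d'%:R) (b%:R)
  => c p p0 j j0 {}dJ {}dU {}dv {}d' b' capU supU avg reply.
(* Add [dJ <= j * dv] to [j] times [dJ + dv <= dU + j * p]. *)
have key : (j + 1) * dJ <= j * ((j + 1) * c + j * p).
  have : j * (dJ + dv) <= j * (dU + j * p) by rewrite ler_pM2l.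
  have : j * dU <= j * ((j + 1) * c) by rewrite ler_pM2l.
  lra.
have key2 : (j + 1) * dJ <= (j + 1) * (j * p + j * c) by nra.
have : dJ <= j * p + j * c by rewrite -(ler_pM2l (_ : 0 < j + 1)) // addr_gt0.
lra.
Qed.

Variable f : R.
Hypothesis f_gt0 : 0 < f.

(** Bounds the chance that a random edge among at least [f] edges at a vertex of [S], with
    [#|S| = s], meets [S] in a further vertex. *)
Definition miss_prob (s : nat) : R := s%:R * pairs / f.

Lemma miss_prob_ge0 s : 0 <= miss_prob s.
Proof. by rewrite divr_ge0 ?mulr_ge0 // ltW. Qed.

Definition small S := (0 < #|S| <= m)%N.

(** An upper estimate of the expected number of small sets still unhit after all outstanding
    services are answered at random. *)
Definition survival r M : R :=
  \sum_(S | small S && [disjoint M & odd_meet k S]) miss_prob #|S| ^+ remaining r S.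

Lemma survival_step r M (F : {set hedge n k}) v : (0 < r v)%N ->
  F \subset star k v -> f <= #|F|%:R ->
  exists2 e, e \in F & survival (serve r v) (e |: M) <= survival r M.
Proof.
(* If every edge of [F] increased [survival], so would their average. *)
move=> rv Fv fF; apply/exists_inP; apply: contraT; rewrite negb_exists_in => /forall_inP no.
have F_gt0 : 0 < #|F|%:R :> R by apply: lt_le_trans fF.
suff : \sum_(e in F) survival (serve r v) (e |: M) <= #|F|%:R * survival r M.
  rewrite leNgt => /negP[]; rewrite mulr_natl -sumr_const.
  apply: ltr_sum => [|e eF]; last by rewrite ltNge; apply: no.
  move: F_gt0; rewrite ltr0n => /card_gt0P[e eF].
  by apply/hasP; exists e; rewrite ?mem_index_enum.
rewrite mulr_sumr /survival.
rewrite (exchange_big_dep (fun S => small S && [disjoint M & odd_meet k S])) /=; last first.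
  by move=> e S _; rewrite disjointsU1l => /and3P[-> _].
apply: ler_sum => S /andP[smallS dis]; have p0 := miss_prob_ge0 #|S|.
rewrite sumr_const -[X in X <= _]mulr_natl (remaining_serve S rv).
set c := #|_|; set t := remaining _ _.
have pt0 : 0 <= miss_prob #|S| ^+ t by rewrite exprn_ge0.
(* For [v] outside [S] the weight is unchanged; for [v] in [S] the exponent drops by one, and few
   edges of [F] leave [S] unhit. *)
have [vS|vS] := boolP (v \in S); last first.
  rewrite add0n ler_wpM2r // ler_nat; apply: subset_leq_card.
  by apply/subsetP=> e /andP[].
rewrite exprD expr1 mulrA ler_wpM2r // /miss_prob.
apply: (@le_trans _ _ (#|S|%:R * pairs)); last first.
  rewrite mulrCA ler_peMr ?mulr_ge0 //.
  by rewrite ler_pdivlMr // mul1r.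
rewrite /pairs -natrM ler_nat.
apply: leq_trans (_ : #|S :\ v| * 'C(n, k.-2) <= _)%N; last first.
  by rewrite leq_mul2r subset_leq_card ?orbT // subD1set.
apply: leq_trans (card_star_touching_le k_gt1 (_ : v \notin S :\ v)); last by rewrite !inE eqxx.
(* An edge through [v] with no other vertex in [S] meets [S] in one vertex and thus hits it. *)
apply: subset_leq_card; apply/subsetP=> e /andP[eF].
rewrite disjointsU1l => /and3P[_ odd_e _]; rewrite inE (subsetP Fv) //=.
rewrite inE; apply: contraNneq odd_e => eSv; rewrite inE.
have ve : v \in val e by have := subsetP Fv _ eF; rewrite inE.
rewrite (_ : val e :&: S = [set v]) ?cards1 //; apply/setP=> u.
move/setP/(_ u): eSv; rewrite !inE; case: eqP => [-> _|_ /=]; first by rewrite ve vS.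
by [].
Qed.

End Services.

Lemma sum_card_sets (R : realFieldType) (T : finType) (m : nat) (g : nat -> R) :
  \sum_(S : {set T} | (0 < #|S| <= m)%N) g #|S| =
  \sum_(1 <= s < m.+1) 'C(#|T|, s)%:R * g s.
Proof.
transitivity (\sum_(S : {set T}) \sum_(1 <= s < m.+1 | s == #|S|) g s).
  rewrite big_mkcond /=; apply: eq_bigr => S _.
  by rewrite (big_nat1_eq +%R) ltnS.
rewrite (exchange_big_dep xpredT) //=; apply: eq_bigr => s _.
rewrite sumr_const mulr_natl -card_draws; congr (_ *+ _).
by apply: eq_card => S; rewrite !inE eq_sym.
Qed.

(** * A winning criterion for Maker *)

Section MakerCriterion.
Variables (R : realFieldType) (n k b m : nat) (f : R).
Hypotheses (k_gt1 : (1 < k)%N) (b_gt0 : (0 < b)%N) (m_gt0 : (0 < m)%N).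
Hypotheses (m_le : (m <= n)%N) (f_gt0 : 0 < f).
Hypothesis stars_free : danger_cap n k b R m 1 + f <= 'C(n.-1, k.-1)%:R.
Hypothesis survival_lt1 :
  \sum_(1 <= s < m.+1) 'C(n, s)%:R * miss_prob n k f s ^+ (2 * s) < 1.
Hypothesis board_large : (4 * n * b < 'C(m, k))%N.

Implicit Types (M B D : {set hedge n k}) (r : 'I_n -> nat) (S : {set 'I_n}).

Let lam : R := es_base R b.

(** The bound on [#|M|] serves to show that the board cannot fill up before all services are
    done. *)
Definition services_left r M B : Prop :=
  [/\ in_budget b r B, danger_capped b R m r B,
      (#|M| + remaining r setT <= 2 * n)%N & survival m f r M < 1].

(** For even [k], a set whose complement has fewer than [m] vertices is left to that complement, by
    [odd_meetC]. *)
Definition large S := (m < #|S|)%N && (odd k || (m <= n - #|S|))%N.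

Definition all_served M B : Prop :=
  (forall S, small m S -> ~~ [disjoint M & odd_meet k S]) /\
  es_potential R (@odd_meet n k) large b M B < lam ^+ 'C(m, k).

Lemma services_left0 : services_left (fun=> 2%N) set0 set0.
Proof.
have rem2 S : remaining (fun=> 2%N) S = (2 * #|S|)%N.
  by rewrite /remaining sum_nat_const mulnC.
have n0 : (0 < n)%N by apply: leq_trans m_le.
split; rewrite ?/in_budget ?cards0 ?rem2 ?cardsT ?card_ord //; first by lia.
  move=> J _ Jm _; rewrite /danger set0I cards0 add0n rem2.
  rewrite mulnA natrM mulrC ler_wpM2l //.
  apply: (@le_trans _ _ ((2 * n * b)%:R / m%:R)); last first.
    rewrite /danger_cap lerDl; apply: sumr_ge0 => i _.
    by rewrite addr_ge0 // divr_ge0.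
  by rewrite ler_pdivlMr ?ltr0n // -natrM ler_nat; nia.
rewrite /survival; apply: le_lt_trans survival_lt1.
have := sum_card_sets 'I_n m (fun s => miss_prob n k f s ^+ (2 * s)).
rewrite card_ord => <-.
rewrite le_eqVlt; apply/orP; left; apply/eqP; apply: eq_big => [S|S _]; last by rewrite rem2.
by rewrite /small -setI_eq0 set0I eqxx andbT.
Qed.

Lemma services_left_step r M B : services_left r M B ->
  (0 < remaining r setT)%N -> M :|: B <> setT ->
  exists2 e, e \notin M :|: B & forall D, (#|D| <= b)%N ->
    exists r', services_left r' (e |: M) (B :|: D).
Proof.
case=> budget capped Mle surv rem0 nc.
have [v0 rv0] : exists v0, (0 < r v0)%N.
  apply/existsP; apply: contraTT rem0; rewrite negb_exists => /forallP no.
  by rewrite -eqn0Ngt /remaining big1 // => i _; apply/eqP; rewrite eqn0Ngt no.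
have [v rv v_max] := @arg_maxnP _ v0 (fun v => 0 < r v)%N (fun v => danger b r B [set v]) rv0.
pose F := star k v :\: B.
have fF : f <= #|F|%:R.
  have cB : (#|B :&: star k v|)%:R <= danger_cap n k b R m 1 :> R.
    have := capped [set v]; rewrite cards1 mul1r => dv.
    apply: le_trans (dv _ _ _) => //; last by move=> u; rewrite inE => /eqP->.
      by rewrite ler_nat /danger touching1 leq_addr.
    by apply/set0Pn; exists v; rewrite inE.
  have : 'C(n.-1, k.-1)%:R = (#|B :&: star k v|)%:R + #|F|%:R :> R.
    by rewrite -natrD -(card_star v (ltnW k_gt1)) -(cardsID B (star k v)) (setIC B).
  move: stars_free cB; lra.
have [e eF surv_e] := survival_step k_gt1 m f_gt0 M rv (subsetDl _ _) fF.
(* Only Breaker's edges were removed from the star, so [e] may already be Maker's; she then claims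
   any free edge, and additional edges only lower [survival]. *)
have [e' e'_free eM] : exists2 e', e' \notin M :|: B & e \in e' |: M.
  have [eM|eM] := boolP (e \in M); last first.
    by exists e; rewrite ?setU11 // inE (negPf eM) /=; move: eF; rewrite inE => /andP[].
  have /set0Pn[e' e'P] : ~: (M :|: B) != set0.
    by apply: contra_notN nc => /eqP /(congr1 (@setC _)); rewrite setCK setC0.
  by exists e'; [rewrite -in_setC | rewrite inE eM orbT].
exists e' => // D cD; exists (serve r v); split.
- exact: (in_budget_reply rv cD budget).
- exact: (danger_capped_reply k_gt1 m_gt0 rv cD v_max budget capped).
- have := (leq_card_setU [set e'] M).1; rewrite cards1.
  by move: Mle; rewrite (remaining_serve setT rv) inE; lia.
apply: le_lt_trans surv; apply: le_trans surv_e.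
rewrite /survival [X in X <= _]big_mkcond [X in _ <= X]big_mkcond /=.
apply: ler_sum => S _; case: (small m S) => //=.
have p0 : 0 <= miss_prob n k f #|S| ^+ remaining (serve r v) S.
  by rewrite exprn_ge0 // miss_prob_ge0.
case: ifP => [dis|_]; last by case: ifP.
rewrite ifT //.
by apply: disjointWl dis; rewrite subUset sub1set eM subsetUr.
Qed.

(** With no service outstanding, an unhit small set would contribute 1 to [survival]. The potential
    has at most [2^n] terms, each bounded through Breaker's at most [2 n b] edges. *)
Lemma all_served_of_services r M B : services_left r M B ->
  remaining r setT = 0%N -> all_served M B.
Proof.
case=> budget _ _ surv rem0.
have rem0S S : remaining r S = 0%N.
  by apply/eqP; move/eqP: rem0; rewrite /remaining !sum_nat_eq0 => /forallP no;
     apply/forallP=> i; apply/implyP=> _; apply: (implyP (no i)); rewrite inE.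
split.
  move=> S smallS; apply/negP=> dis; move: surv; rewrite ltNge /survival => /negP[].
  rewrite (bigD1 S) /=; last by rewrite smallS.
  by rewrite rem0S expr0 lerDl; apply: sumr_ge0 => S' _; rewrite exprn_ge0 // miss_prob_ge0.
have lam1 : 1 <= lam by apply: es_base_ge1.
have lam1' : 1 < lam by rewrite /lam /es_base ltrDl invr_gt0 mulr_gt0 ?ltr0n.
(* Half of the exponent [4 n b] pays for the [2^n] sets, since [lam ^+ (2 * b)] is at least 2. *)
apply: (@le_lt_trans _ _ (lam ^+ (2 * b * n + 2 * n * b))); last first.
  by rewrite ltr_eXn2l //; move: board_large; lia.
rewrite exprD; apply: (@le_trans _ _ ((2 ^ n)%:R * lam ^+ (2 * n * b))); last first.
  rewrite ler_wpM2r ?exprn_ge0 ?(le_trans ler01) // natrX exprM.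
  apply: lerXn2r; rewrite ?nnegrE ?ler0n ?exprn_ge0 ?(le_trans ler01) //.
  exact: (es_base_expr_ge R b_gt0).
rewrite /es_potential; apply: (@le_trans _ _ (\sum_(S : {set 'I_n}) lam ^+ (2 * n * b))).
  rewrite big_mkcond /=; apply: ler_sum => S _; case: ifP => _; last by rewrite exprn_ge0 ?(le_trans ler01).
  apply: ler_weXn2l => //; apply: leq_trans (subset_leq_card (subsetIl _ _)) _.
  by move: budget; rewrite /in_budget rem0 muln0 addn0.
by rewrite sumr_const -[X in X <= _]mulr_natl -cardsT -powersetT card_powerset cardsT card_ord.
Qed.

Lemma all_served_full_rank M B : all_served M B -> M :|: B = setT ->
  has_full_rank M.
Proof.
move=> [hit pot] full; apply: has_full_rank_of_hits => [S S0 SnT|]; last first.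
  by move=> _; apply: leq_trans m_le.
apply/negP=> dis.
have cS0 : (0 < #|S|)%N by rewrite card_gt0.
have [Sm|Sm] := leqP #|S| m.
  by have := hit S; rewrite /small cS0 Sm dis => /(_ isT).
have SC : (n - #|S|)%N = #|~: S| by rewrite (cardsCs (~: S)) setCK card_ord.
have [largeS|] := boolP (large S); last first.
  rewrite /large Sm negb_or -ltnNge => /andP[ek Cm].
  have := hit (~: S); rewrite odd_meetC // dis /small -SC (ltnW Cm) andbT subn_gt0.
  have -> : (#|S| < n)%N.
    rewrite ltn_neqAle -[n in (_ <= n)%N]card_ord max_card andbT.
    by apply: contraNneq (SnT ek) => cS; rewrite eqEcard subsetT cardsT card_ord cS /=.
  by move/(_ isT).
(* On the full board an unhit set is owned by Breaker, and its term alone reaches the bound on the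
   potential. *)
have sub : odd_meet k S \subset B.
  apply/subsetP=> e eS; have : e \in M :|: B by rewrite full inE.
  by rewrite inE => /orP[eM|//]; move/pred0P/(_ e): dis; rewrite /= eM eS.
move: pot; rewrite ltNge => /negP[].
have lam1 : 1 <= lam by apply: es_base_ge1.
rewrite /es_potential (bigD1 S) /=; last by rewrite largeS.
apply: (@le_trans _ _ (lam ^+ #|B :&: odd_meet k S|)); last first.
  by rewrite lerDl; apply: sumr_ge0 => S' _; rewrite exprn_ge0 ?(le_trans ler01).
rewrite (setIidPr sub) ler_weXn2l //.
apply: card_odd_meet_ge; [exact: ltnW | exact: ltnW |].
by move=> ek; move: largeS; rewrite /large (negPf ek) => /andP[].
Qed.

Lemma rank_game_maker_criterion : rank_game_maker_wins n k b.
Proof.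
have [e0 _] : exists e0 : hedge n k, true.
  have : (0 < #|[set A : {set 'I_n} | #|A| == k]|)%N.
    rewrite card_draws card_ord; apply: leq_trans (leq_bin2l k m_le).
    by apply: leq_trans board_large.
  case/card_gt0P=> A; rewrite inE => cA.
  by exists (exist (fun A : {set 'I_n} => #|A| == k) A cA).
apply: (@maker_wins_by_invariant _ _ _ e0 (fun M B =>
   (exists r, services_left r M B) \/ all_served M B)).
- by left; exists (fun=> 2%N); apply: services_left0.
- move=> M B Inv nc; have [[r [left_r rem0]]|served] :
      (exists r, services_left r M B /\ (0 < remaining r setT)%N) \/ all_served M B.
    case: Inv => [[r left_r]|]; last by right.
    have [rem0|rem0] := posnP (remaining r setT); last by left; exists r.
    by right; apply: all_served_of_services left_r rem0.
  - have [e e_free eD] := services_left_step left_r rem0 nc.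
    by exists e => // D cD; left; apply: eD.
  have [e e_free eD] := es_step R (@odd_meet n k) large b_gt0 nc.
  exists e => // D cD; right; split.
    move=> S /(proj1 served); apply: contra; apply: disjointWl; exact: subsetUr.
  by apply: le_lt_trans (eD D cD) (proj2 served).
move=> M B Inv full; apply: (all_served_full_rank _ full).
case: Inv => // -[r left_r]; apply: (all_served_of_services left_r).
have [budget _ Mle _] := left_r.
(* A board full during the services would have at most [4 n b] edges, against [board_large]. *)
have cE : (#|[set: hedge n k]| <= 2 * n + 2 * n * b)%N.
  rewrite -full; apply: leq_trans (leq_card_setU _ _).1 _; apply: leq_add.
    by apply: leq_trans Mle; apply: leq_addr.
  by apply: leq_trans budget; apply: leq_addr.
suff : ('C(m, k) <= #|[set: hedge n k]|)%N by move: cE board_large; nia.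
apply: leq_trans (leq_bin2l k m_le) _.
rewrite -[n in 'C(n, _)]card_ord -card_draws.
rewrite (_ : [set: hedge n k] = [set e : hedge n k | predT (val e)]); last by apply/setP=> e; rewrite !inE.
rewrite card_hedges; apply: subset_leq_card; apply/subsetP=> A; by rewrite !inE andbT.
Qed.

End MakerCriterion.

(** * Initial expected number of unhit small sets *)

Section SurvivalSum.
Variable R : realFieldType.

Lemma sum_half_powers (m : nat) : \sum_(1 <= s < m.+1) 2^-1 ^+ s.-1 <= 2 :> R.
Proof.
suff -> : \sum_(1 <= s < m.+1) 2^-1 ^+ s.-1 = 2 - 2 * 2^-1 ^+ m :> R.
  by rewrite gerBl mulr_ge0 // exprn_ge0 // invr_ge0.
elim: m => [|m IHm]; first by rewrite big_geq // expr0 mulr1 subrr.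
rewrite big_nat_recr //= IHm exprS; lra.
Qed.

(** By [bin_self_expn_le] each term is at most [(a s)^s]. The two services square the miss
    probability and so leave a factor of order [1 / n] in [a]; a single one would leave only
    [(4 L)^s]. *)
Lemma survival_sum_lt1 (n m : nat) (p : nat -> R) (a L : R) :
  (0 < n)%N -> (forall s, 0 <= p s <= L * s%:R / n%:R) ->
  a * n%:R = 4 * L ^+ 2 -> a * m%:R <= 4^-1 -> 2 * a < 1 ->
  \sum_(1 <= s < m.+1) 'C(n, s)%:R * p s ^+ (2 * s) < 1.
Proof.
move=> n0 p_le an am a2; have n0R : 0 < n%:R :> R by rewrite ltr0n.
have a0 : 0 <= a by rewrite -(ler_pM2r n0R) mul0r an mulr_ge0 // sqr_ge0.
apply: le_lt_trans a2; apply: (@le_trans _ _ (\sum_(1 <= s < m.+1) a * 2^-1 ^+ s.-1)).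
  rewrite !big_nat; apply: ler_sum => s /andP[s1 sm].
  have /andP[p0 ps] := p_le s.
  apply: (@le_trans _ _ ((a * s%:R) ^+ s)).
    rewrite exprM; apply: (@le_trans _ _ ('C(n, s)%:R * ((L * s%:R / n%:R) ^+ 2) ^+ s)).
      rewrite ler_wpM2l // lerXn2r ?nnegrE ?sqr_ge0 //.
      by rewrite lerXn2r ?nnegrE // (le_trans p0).
    have -> : (L * s%:R / n%:R) ^+ 2 = s%:R * (a * s%:R / (4 * n%:R)).
      have -> : a = 4 * L ^+ 2 / n%:R by rewrite -an mulfK // gt_eqF.
      by field; rewrite gt_eqF.
    rewrite exprMn mulrA -natrX -(natrM _ 'C(n, s)).
    apply: (@le_trans _ _ (((4 * n) ^ s)%:R * (a * s%:R / (4 * n%:R)) ^+ s)).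
      rewrite ler_wpM2r ?ler_nat ?bin_self_expn_le // exprn_ge0 //.
      by rewrite divr_ge0 // ?mulr_ge0.
    rewrite natrX natrM -exprMn mulrC divfK //.
    by rewrite mulf_neq0 // ?gt_eqF.
  rewrite -[in X in _ ^+ X](prednK s1) exprS.
  have as4 : a * s%:R <= 4^-1.
    by apply: le_trans am; rewrite ler_wpM2l // ler_nat.
  apply: (@le_trans _ _ (a * s%:R * 4^-1 ^+ s.-1)).
    by rewrite ler_wpM2l ?mulr_ge0 // lerXn2r ?nnegrE ?mulr_ge0 // invr_ge0.
  have -> : 4^-1 = 2^-1 * 2^-1 :> R by lra.
  rewrite exprMn mulrA ler_wpM2r ?exprn_ge0 ?invr_ge0 // -mulrA ler_piMr //.
  rewrite exprVn ler_pdivrMr ?exprn_gt0 // mul1r -natrX ler_nat.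
  by rewrite -[in X in (X <= _)%N](prednK s1) ltn_expl.
by rewrite -mulr_sumr mulrC ler_wpM2r // sum_half_powers.
Qed.

End SurvivalSum.

(** * Parameters for Maker *)

Section MakerAsymptotics.
Variables (R : realType) (k : nat).
Hypothesis k_gt1 : (1 < k)%N.

Lemma bin_ge_expn (n m : nat) (d : R) : 0 <= d -> d * n%:R <= 2 * m%:R -> (2 * k <= m)%N ->
  (d / 4 * n%:R) ^+ k <= 'C(m, k)%:R * k`!%:R.
Proof.
move=> d0 dn km; rewrite -natrM bin_ffact.
apply: (@le_trans _ _ ((m - k) ^ k)%:R); last by rewrite ler_nat expn_le_ffact.
rewrite natrX lerXn2r ?nnegrE ?ler0n //; first by rewrite mulr_ge0 // divr_ge0.
have : (m <= 2 * (m - k))%N by move: km; clear; lia.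
rewrite -(ler_nat R) natrM; lra.
Qed.

Lemma danger_cap1_le (n b m : nat) (d : R) : (0 < m)%N -> (m <= n)%N ->
  0 < d -> d * n%:R <= 2 * m%:R ->
  danger_cap n k b R m 1 <=
    b%:R * (4 / d + 1 + ln n%:R) + m%:R * 'C(n, k.-2)%:R.
Proof.
move=> m0 mn d0 dn; have m0R : 0 < m%:R :> R by rewrite ltr0n.
rewrite /danger_cap big_split /= sumr_const_nat -(mulr_natl 'C(n, k.-2)%:R) addrA.
apply: lerD; last by rewrite ler_wpM2r // ler_nat leq_subr.
rewrite -addrA mulrDr; apply: lerD.
  rewrite natrM natrM mulrAC mulrC ler_wpM2l // ler_pdivrMr // mulrAC ler_pdivlMr //.
  lra.
rewrite -mulr_sumr ler_wpM2l //.
apply: (@le_trans _ _ (1 + ln m%:R)).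
  apply: le_trans (harmonic_le_ln _ m0); rewrite big_nat_recr //= lerDl.
  by rewrite invr_ge0.
by rewrite lerD2l ler_ln ?posrE ?ltr0n ?ler_nat // (leq_trans m0).
Qed.

(** Here [m] is linear in [n] and [f = eps / 4 * N]. Of the slack [eps * N], one quarter each goes
    to the lower order part of the harmonic sum, the double counted pairs, the reserve [f], and the
    passage from ['C(n, k.-1)] to ['C(n.-1, k.-1)]. *)
Lemma maker_parameters (eps : R) : 0 < eps -> eps <= 2^-1 ->
  exists n0 : nat, forall n, (n0 <= n)%N ->
  forall b : nat, b%:R * ln n%:R <= (1 - eps) * 'C(n, k.-1)%:R ->
  exists (m : nat) (f : R), [/\ (0 < m)%N, (m <= n)%N, 0 < f,
    danger_cap n k b R m 1 + f <= 'C(n.-1, k.-1)%:R &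
    \sum_(1 <= s < m.+1) 'C(n, s)%:R * miss_prob n k f s ^+ (2 * s) < 1 /\
    (4 * n * b < 'C(m, k))%N].
Proof.
move=> eps0 eps_half; pose K : R := k%:R.
have K2 : 2 <= K by rewrite /K ler_nat.
have K0 : 0 < K by lra.
have KK : 4 <= K ^+ 2 by rewrite expr2; nra.
(* With this [f], [pairs_le] bounds [miss_prob] at [s] by [L s / n]. *)
pose L := 8 * K / eps.
(* Then [m <= d n] gives [4 L^2 m / n <= 1 / 4], as [survival_sum_lt1] demands. *)
pose d := (16 * L ^+ 2)^-1.
have L0 : 0 < L by rewrite divr_gt0 // mulr_gt0.
have L_eps : L * eps = 8 * K by rewrite divfK // gt_eqF.
have L1 : 1 <= L by rewrite -(ler_pM2r eps0) L_eps; lra.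
have d0 : 0 < d by rewrite invr_gt0 mulr_gt0 // exprn_gt0.
have dL : d * (16 * L ^+ 2) = 1 by rewrite mulVf // gt_eqF // mulr_gt0 // exprn_gt0.
have dLL : d * L * 16 <= 1.
  by rewrite -[X in _ <= X]dL -mulrA ler_pM2l // mulrC ler_pM2l // expr2 ler_peMr // ltW.
have dK : d * (2 * K) <= eps / 4.
  have -> : 2 * K = L * eps / 4 by rewrite L_eps; field.
  rewrite mulrA mulrA ler_pM2r ?invr_gt0 // ler_piMl //; first exact: ltW.
  have := mulr_gt0 d0 L0; lra.
have d1 : d <= eps / 8 by nra.
pose X : R := Num.max (Num.max (2 * K) (4 * K / d))
  (Num.max ((4 / d + 1) * (4 / eps)) (Num.max 1 (4 * k`!%:R * (4 / d) ^+ k + 1))).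
have [n0 n0P] := large_nat_ln X; exists n0 => n /n0P[Xn Xx] b.
move: Xn Xx; rewrite /X !ge_max.
move=> /andP[/andP[n_2k n_d] _] /andP[_ /and3P[x_d x1 x_big]].
have n_2kN : (2 * k <= n)%N by rewrite -(ler_nat R) natrM.
have n0N : (0 < n)%N by move: n_2kN k_gt1; clear; lia.
have n0R : 0 < n%:R :> R by rewrite ltr0n.
set x := ln n%:R in x_d x1 x_big *; have x0 : 0 < x by lra.
pose N : R := 'C(n, k.-1)%:R.
have N0 : 0 < N by rewrite ltr0n bin_gt0; move: n_2kN; clear; lia.
rewrite -/N => bx.
have dn : 4 * K <= d * n%:R by rewrite [d * _]mulrC -ler_pdivrMr.
have [|m [m0 m_le m_ge]] := @truncn_half _ (d * n%:R); first by lra.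
have m0R : 0 < m%:R :> R by rewrite ltr0n.
have m_n : (m <= n)%N.
  rewrite -(ler_nat R); apply: le_trans m_le _; rewrite ler_piMl //; lra.
have m_2k : (2 * k <= m)%N by rewrite -(ler_nat R) natrM -/K; lra.
pose f := eps / 4 * N.
have f0 : 0 < f by rewrite mulr_gt0 // divr_gt0.
have pairs : n%:R * 'C(n, k.-2)%:R <= 2 * K * N.
  by have := pairs_le k_gt1 n_2kN; rewrite -(ler_nat R) !natrM.
have P0 : 0 <= 'C(n, k.-2)%:R :> R by [].
have b0 : 0 <= b%:R :> R by [].
have bxN : b%:R * x <= N by apply: le_trans bx _; nra.
exists m, f; split => //.
- apply: le_trans (_ : b%:R * (4 / d + 1 + x) + m%:R * 'C(n, k.-2)%:R + f <= _).
    by rewrite lerD2r; apply: danger_cap1_le.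
  have h1 : m%:R * 'C(n, k.-2)%:R <= eps / 4 * N.
    apply: le_trans (_ : d * (n%:R * 'C(n, k.-2)%:R) <= _).
      by rewrite mulrA ler_wpM2r.
    apply: le_trans (_ : d * (2 * K * N) <= _); first by rewrite ler_pM2l.
    by rewrite mulrA ler_pM2r.
  have h2 : b%:R * (4 / d + 1) <= eps / 4 * N.
    have : (4 / d + 1) <= eps / 4 * x.
      by move: x_d; rewrite -ler_pdivlMr ?divr_gt0 // invf_div [x * _]mulrC.
    move=> h; apply: le_trans (_ : b%:R * (eps / 4 * x) <= _); first by rewrite ler_wpM2l.
    by rewrite mulrCA ler_pM2l ?divr_gt0.
  have h3 : N - eps / 4 * N <= 'C(n.-1, k.-1)%:R.
    rewrite -(ler_pM2l n0R) -natrM mul_bin_down natrM -/N.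
    have -> : (n - k.-1)%:R = n%:R - k.-1%:R :> R.
      by rewrite natrB //; move: n_2kN; clear; lia.
    have kn : k.-1%:R <= n%:R * (eps / 4) :> R.
      apply: le_trans (_ : K <= _); first by rewrite ler_nat leq_pred.
      nra.
    rewrite mulrBr mulrBl lerD2l lerN2 [in X in _ <= X]mulrA ler_wpM2r //; lra.
  rewrite mulrDr; rewrite /f; lra.
have L16 : 0 < 16 * L ^+ 2 by rewrite mulr_gt0 // exprn_gt0.
have dnL : 16 * L ^+ 2 * (d * n%:R) = n%:R by rewrite mulrA [_ * d]mulrC dL mul1r.
split.
  apply: (@survival_sum_lt1 _ n m _ (4 * L ^+ 2 / n%:R) L) => //.
  - move=> s; rewrite miss_prob_ge0 //= /miss_prob ler_pdivrMr // mulrAC ler_pdivlMr //.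
    rewrite -mulrA [_ * n%:R]mulrC; apply: le_trans (ler_wpM2l (ler0n _ _) pairs) _.
    rewrite /f le_eqVlt; apply/orP; left; apply/eqP.
    have -> : L * s%:R * (eps / 4 * N) = (L * eps) * s%:R * N / 4 by field.
    by rewrite L_eps; field.
  - by rewrite divfK // gt_eqF.
  - rewrite mulrAC ler_pdivrMr //.
    have := ler_wpM2l (ltW L16) m_le; rewrite dnL; lra.
  - rewrite mulrA ltr_pdivrMr // mul1r.
    have := ler_wpM2l (ltW L16) dn; rewrite dnL; nra.
(* ['C(m, k)] has order [n^k], while [n b] is at most [n^k / ln n]; the last entry of [X] makes
   [ln n] beat the constants. *)
have big := bin_ge_expn (ltW d0) m_ge m_2k.
have fact0 : 0 < k`!%:R :> R by rewrite ltr0n fact_gt0.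
rewrite -(ltr_nat R) -(ltr_pM2r fact0); apply: lt_le_trans big.
have N_le : N <= n%:R ^+ k.-1 by rewrite -natrX ler_nat bin_le_expn.
have nb : n%:R * b%:R * x <= n%:R ^+ k.
  rewrite -(prednK (ltnW k_gt1)) exprS -mulrA ler_pM2l //.
  exact: le_trans bxN N_le.
rewrite -(ltr_pM2r x0) exprMn.
have e4 : (4 / d) ^+ k * (d / 4) ^+ k = 1.
  by rewrite -exprMn (_ : _ * _ = 1) ?expr1n //; field; rewrite gt_eqF.
have q0 : 0 < (d / 4) ^+ k by rewrite exprn_gt0 // divr_gt0.
have nk0 : 0 < n%:R ^+ k :> R by rewrite exprn_gt0.
apply: (@le_lt_trans _ _ (4 * k`!%:R * n%:R ^+ k)).
  rewrite natrM natrM (_ : _ * x = 4 * k`!%:R * (n%:R * b%:R * x)); last by ring.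
  by rewrite ler_pM2l // mulr_gt0.
rewrite [X in _ < X]mulrAC ltr_pM2r //.
have -> : 4 * k`!%:R = (d / 4) ^+ k * (4 * k`!%:R * (4 / d) ^+ k) :> R.
  by rewrite [RHS]mulrC -[RHS]mulrA e4 mulr1.
by rewrite ltr_pM2l //; lra.
Qed.

End MakerAsymptotics.

Theorem theorem2 (R : realType) (k : nat) (k_ge2 : (2 <= k)%N)
    (eps : R) (eps_gt0 : 0 < eps) :
  exists n0 : nat, forall n : nat, (n0 <= n)%N ->
    forall (b : nat) (beta : R), (0 < b)%N ->
      b%:R = beta * 'C(n, k.-1)%:R / ln n%:R ->
      (beta <= 1 - eps -> rank_game_maker_wins n k b) /\
      (1 + eps <= beta -> rank_game_breaker_wins n k b).
Proof.
(* For Maker a smaller [eps] only admits more values of [beta]. *)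
pose eps' := Num.min eps 2^-1.
have eps'0 : 0 < eps' by rewrite lt_min eps_gt0 invr_gt0 ltr0n.
have eps'_half : eps' <= 2^-1 by rewrite ge_min lexx orbT.
have [n1 n1P] := maker_parameters k_ge2 eps'0 eps'_half.
have [n2 n2P] := breaker_parameters k_ge2 eps_gt0.
have [n3 n3P] := large_nat_ln (1 : R).
exists (maxn (maxn n1 n2) (maxn n3 2)) => n.
rewrite !geq_max => /andP[/andP[n1n n2n] /andP[/n3P[_ ln_ge1] n_gt1]] b beta b_gt0 b_eq.
have ln_gt0 : 0 < ln n%:R :> R by apply: lt_le_trans ln_ge1.
have bln : b%:R * ln n%:R = beta * 'C(n, k.-1)%:R by rewrite b_eq divfK // gt_eqF.
split=> beta_le.
  have [|m [f [m_gt0 m_le f_gt0 stars [surv board]]]] := n1P n n1n b.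
    rewrite bln ler_wpM2r //; apply: le_trans beta_le _.
    by rewrite lerD2l lerN2 ge_min lexx.
  exact: (rank_game_maker_criterion k_ge2 b_gt0 m_gt0 m_le f_gt0 stars surv board).
have [|m [m_gt0 m_n clearing boxes]] := n2P n n2n b.
  by rewrite bln ler_wpM2r.
exact: (rank_game_breaker_criterion k_ge2 m_gt0 m_n n_gt1 clearing boxes).
Qed.
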